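(* Let $n\ge3$, $K,H\le\mathbb{H}^\times$ finite with $[K,K]\le H\trianglelefteq K$, $H\ne\{1\}$. A set of representatives of the $G_n(K,H)$-conjugacy classes of parabolic subgroups of $G_n(K,H)$ is given as follows. (a) If $K/H$ is cyclic, let $\alpha\in K$ be an element whose coset generates $K/H$; the representatives are (i) $P_\lambda$ for all partitions $\lambda\vdash m$ with $0\le m<n$, and (ii) $P_\lambda^{\alpha^s}$ for all partitions $\lambda=(\lambda_1,\dots,\lambda_k)\vdash n$ and $0\le s<\gcd([K:H],\lambda_1,\dots,\lambda_k)$. (b) If $K$ is a binary dihedral group of order $8d$ ($d\ge2$) and $H=[K,K]$ (cyclic of order $2d$, so $K/H\cong C_2\times C_2$), let $1,\alpha,\beta,\gamma$ be representatives of the cosets of $H$ in $K$; the representatives are (i) $P_\lambda$ for $\lambda\vdash m$, $0\le m<n$; (ii) $P_\lambda$ for $\lambda=(\lambda_1,\dots,\lambda_k)\vdash n$ with $\gcd(\lambda_1,\dots,\lambda_k)$ odd; (iii) $P_\lambda^1,P_\lambda^\alpha,P_\lambda^\beta,P_\lambda^\gamma$ for $\lambda=(\lambda_1,\dots,\lambda_k)\vdash n$ with $\gcd(\lambda_1,\dots,\lambda_k)$ even.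
   Context: $\mathbb{H}$: quaternions. $A_n(K,H)$: diagonal matrices $\mathrm{diag}(k_1,\dots,k_n)$, $k_i\in K$, $k_1\cdots k_n\in H$; $G_n(K,H)$: group generated by $A_n(K,H)$ and permutation matrices $M(\sigma)$, acting on $\mathbb{H}^n$ by left multiplication. Parabolic subgroup: pointwise stabilizer in $G_n(K,H)$ of a subset of $\mathbb{H}^n$. By the classification, the finite subgroups $H\trianglelefteq K\le\mathbb{H}^\times$ with $[K,K]\le H$ have $K/H$ non-cyclic only in case (b). For a parabolic triple $(I_0,\Pi=(I_1,\dots,I_d),\xi)$ ($I_0\subseteq\{1,\dots,n\}$, $\Pi$ a set partition of the complement, $\xi:\{1,\dots,n\}\setminus I_0\to K$) let $D_\xi$ be the diagonal matrix with entries $\xi(j)$ for $j\notin I_0$ and $1$ for $j\in I_0$, and $P_{(I_0,\Pi,\xi)}=P_0\times P_1\times\dots\times P_d$ with $P_0=G_{|I_0|}(K,H)$ acting on the coordinates in $I_0$ (trivially elsewhere; omitted if $I_0=\emptyset$) and $P_i=\{D_\xi M(\sigma)D_\xi^{-1}:\sigma\in\mathrm{Sym}(I_i)\}$. For a partition $\lambda=(\lambda_1,\dots,\lambda_k)$ of $m\in\{0,\dots,n\}$ with partial sums $m_i=\lambda_1+\dots+\lambda_i$, $m_0=0$, put $I_0=\{m+1,\dots,n\}$, $I_i=\{m_{i-1}+1,\dots,m_i\}$, and for $\alpha\in K$ let $\xi_\alpha(1)=\alpha$, $\xi_\alpha(i)=1$ ($i\ge2$); $P_\lambda^\alpha=P_{(I_0,(I_1,\dots,I_k),\xi_\alpha)}$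 and $P_\lambda=P_\lambda^1$. *)

(* Defs.v *)
From HB Require Import structures.
From mathcomp Require Import all_boot all_order all_algebra all_fingroup.
From mathcomp Require Import reals.
From mathcomp Require Import finmap.
From mathcomp Require Import ring lra.
Set Implicit Arguments. Unset Strict Implicit. Unset Printing Implicit Defensive.
Import Order.TTheory GRing.Theory Num.Theory.
Local Open Scope ring_scope.

Record quat (R : Type) : Type := Quat { qre : R; qi : R; qj : R; qk : R }.

Module QuatEqChoice.
Definition seq_of_quat (R : Type) (x : quat R) :=
  let: Quat a b c d := x in [:: a; b; c; d].
Definition quat_of_seq (R : Type) (x : seq R) :=
  if x is [:: a; b; c; d] then Some (Quat a b c d) else None.
Lemma quat_of_seqK (R : Type) : pcancel (@seq_of_quat R) (@quat_of_seq R).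
Proof. by case. Qed.
End QuatEqChoice.

HB.instance Definition _ (R : eqType) := Equality.copy (quat R)
  (pcan_type (@QuatEqChoice.quat_of_seqK R)).
HB.instance Definition _ (R : choiceType) := Choice.copy (quat R)
  (pcan_type (@QuatEqChoice.quat_of_seqK R)).

Section QuatRing.
Variable R : comNzRingType.
Definition qadd (x y : quat R) :=
  let: Quat a b c d := x in let: Quat a' b' c' d' := y in
  Quat (a + a') (b + b') (c + c') (d + d').
Definition qopp (x : quat R) := let: Quat a b c d := x in Quat (- a) (- b) (- c) (- d).
Definition qzero : quat R := Quat 0 0 0 0.
Program Definition quat_zmodMixin := @GRing.isZmodule.Build (quat R)
  qzero qopp qadd _ _ _ _.
Next Obligation. by move=> [a b c d] [a' b' c' d'] [a'' b'' c'' d''] /=; rewrite !addrA. Qed.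
Next Obligation. by move=> [a b c d] [a' b' c' d'] /=; congr Quat; rewrite addrC. Qed.
Next Obligation. by move=> [a b c d] /=; rewrite !add0r. Qed.
Next Obligation. by move=> [a b c d] /=; rewrite !addNr. Qed.
HB.instance Definition _ := quat_zmodMixin.

(* Hamilton product: i^2 = j^2 = k^2 = ijk = -1 *)
Definition qmul (x y : quat R) :=
  let: Quat a1 b1 c1 d1 := x in let: Quat a2 b2 c2 d2 := y in
  Quat (a1 * a2 - b1 * b2 - c1 * c2 - d1 * d2)
       (a1 * b2 + b1 * a2 + c1 * d2 - d1 * c2)
       (a1 * c2 - b1 * d2 + c1 * a2 + d1 * b2)
       (a1 * d2 + b1 * c2 - c1 * b2 + d1 * a2).
Definition qone : quat R := Quat 1 0 0 0.
Program Definition quat_ringMixin := @GRing.Zmodule_isNzRing.Build (quat R)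
  qone qmul _ _ _ _ _ _.
Next Obligation. by move=> [? ? ? ?] [? ? ? ?] [? ? ? ?] /=; congr Quat; ring. Qed.
Next Obligation. by move=> [? ? ? ?] /=; congr Quat; ring. Qed.
Next Obligation. by move=> [? ? ? ?] /=; congr Quat; ring. Qed.
Next Obligation. by move=> [? ? ? ?] [? ? ? ?] [? ? ? ?] /=; congr Quat; ring. Qed.
Next Obligation. by move=> [? ? ? ?] [? ? ? ?] [? ? ? ?] /=; congr Quat; ring. Qed.
Next Obligation. by apply/eqP => -[] /eqP; rewrite oner_eq0. Qed.
HB.instance Definition _ := quat_ringMixin.
End QuatRing.


Section QuatUnit.
Variable R : realFieldType.
Definition qnorm2 (x : quat R) :=
  let: Quat a b c d := x in a ^+ 2 + b ^+ 2 + c ^+ 2 + d ^+ 2.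
Definition qunit : pred (quat R) := fun x => x != 0.
Definition qinv (x : quat R) :=
  if x == 0 then x else
  let: Quat a b c d := x in let n := qnorm2 x in
  Quat (a / n) (- b / n) (- c / n) (- d / n).

Lemma qnorm2_neq0 (x : quat R) : x != 0 -> qnorm2 x != 0.
Proof.
case: x => a b c d; apply: contra => /= /eqP H.
have ha : 0 <= a ^+ 2 := sqr_ge0 a. have hb : 0 <= b ^+ 2 := sqr_ge0 b.
have hc : 0 <= c ^+ 2 := sqr_ge0 c. have hd : 0 <= d ^+ 2 := sqr_ge0 d.
have a0 : a ^+ 2 = 0 by lra. have b0 : b ^+ 2 = 0 by lra.
have c0 : c ^+ 2 = 0 by lra. have d0 : d ^+ 2 = 0 by lra.
move: a0 b0 c0 d0 => /eqP; rewrite sqrf_eq0 => /eqP -> /eqP; rewrite sqrf_eq0 => /eqP ->.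
by move=> /eqP; rewrite sqrf_eq0 => /eqP -> /eqP; rewrite sqrf_eq0 => /eqP ->.
Qed.

Lemma qmulVr : {in qunit, left_inverse 1 qinv *%R}.
Proof.
move=> x ux; rewrite /qinv (negbTE ux); have := qnorm2_neq0 ux.
case: x ux => a b c d _ /= nz; congr Quat; field => //.
Qed.
Lemma qdivrr : {in qunit, right_inverse 1 qinv *%R}.
Proof.
move=> x ux; rewrite /qinv (negbTE ux); have := qnorm2_neq0 ux.
case: x ux => a b c d _ /= nz; congr Quat; field => //.
Qed.
Lemma qunitrP (x y : quat R) : y * x = 1 /\ x * y = 1 -> qunit x.
Proof.
move=> [yx _]; apply/eqP => x0; move: yx; rewrite x0 mulr0 => /eqP.
by rewrite eq_sym oner_eq0.
Qed.
Lemma qinvr_out : {in [predC qunit], qinv =1 id}.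
Proof. by move=> x; rewrite inE /= negbK /qinv => ->. Qed.
HB.instance Definition _ := GRing.NzRing_hasMulInverse.Build (quat R)
  qmulVr qdivrr qunitrP qinvr_out.
End QuatUnit.

Local Open Scope fset_scope.

Section Subgroups.
Variable R : realFieldType.
Implicit Types K H L : {fset quat R}.

Definition is_qsubgroup K :=
  [/\ 1 \in K,
      (forall x y, x \in K -> y \in K -> x * y \in K) &
      (forall x, x \in K -> x \is a GRing.unit /\ x^-1 \in K)].

Definition normal_in H K :=
  [/\ is_qsubgroup H, H `<=` K &
      forall k h, k \in K -> h \in H -> k * h * k^-1 \in H].

Definition commutators_in K L :=
  forall a b, a \in K -> b \in K -> a^-1 * b^-1 * a * b \in L.

Definition is_commutator_subgroup H K :=
  [/\ is_qsubgroup H, commutators_in K H &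
      forall L, is_qsubgroup L -> commutators_in K L -> H `<=` L].

Definition qindex K H := (#|` K| %/ #|` H|)%N.

Definition binary_dihedral K (m : nat) :=
  exists a x : quat R,
    [/\ a ^+ (2 * m) = 1, (forall i, (0 < i < 2 * m)%N -> a ^+ i != 1),
        x ^+ 2 = a ^+ m, x * a * x^-1 = a^-1 &
        [/\ forall k, k \in K <-> exists i e, k = a ^+ i * x ^+ e,
            a \in K, x \in K & #|` K| = (4 * m)%N]].
End Subgroups.

Section Parabolic.
Variable R : realFieldType.
Variables (K H : {fset quat R}) (n : nat).
Local Notation M := 'M[quat R]_n.
Local Notation qset := (M -> Prop).

Definition diagq (f : 'I_n -> quat R) : M := diag_mx (\row_j f j).

Definition A_gens (I : {set 'I_n}) : qset := fun g =>
  exists k : 'I_n -> quat R,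
    [/\ forall j, j \in I -> k j \in K,
        forall j, j \notin I -> k j = 1,
        \prod_(j < n | j \in I) k j \in H & g = diagq k].

Definition perm_gens (I : {set 'I_n}) : qset := fun g =>
  exists s : 'S_n, perm_on I s /\ g = perm_mx s.

Definition inverses (S : qset) : qset := fun g =>
  exists s, S s /\ s *m g = 1%:M /\ g *m s = 1%:M.
Inductive generated (S : qset) : qset :=
  | gen_one : generated S 1%:M
  | gen_mul s g : S s \/ inverses S s -> generated S g -> generated S (s *m g).

(* G_{|I|}(K,H) acting on the coordinates in I (trivially elsewhere) *)
Definition G_on (I : {set 'I_n}) : qset :=
  generated (fun g => A_gens I g \/ perm_gens I g).

Definition Gn : qset := G_on setT.

Definition parabolic (P : qset) :=
  exists X : 'cV[quat R]_n -> Prop,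
    P = (fun g => Gn g /\ forall v, X v -> g *m v = v).

Definition Gconjugate (P Q : qset) :=
  exists g g', [/\ Gn g, Gn g', g *m g' = 1%:M, g' *m g = 1%:M &
    Q = (fun x => exists p, P p /\ x = g *m p *m g')].

Fixpoint prod_sets (l : seq qset) : qset :=
  match l with
  | [::] => fun g => g = 1%:M
  | S0 :: l' => fun g => exists a b, [/\ S0 a, prod_sets l' b & g = a *m b]
  end.

(* P_(I0, Pi, xi), with xi given as a function on all coordinates whose
   values on I0 are ignored *)
Definition P_triple (I0 : {set 'I_n}) (Pi : seq {set 'I_n}) (xi : 'I_n -> quat R)
    : qset :=
  let D := diagq (fun j => if j \in I0 then 1 else xi j) in
  let Dinv := diagq (fun j => if j \in I0 then 1 else (xi j)^-1) in
  let Pblock (I : {set 'I_n}) : qset := fun g =>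
    exists s : 'S_n, perm_on I s /\ g = D *m perm_mx s *m Dinv in
  prod_sets (G_on I0 :: map Pblock Pi).

Fixpoint blocks_from (off : nat) (l : seq nat) : seq {set 'I_n} :=
  match l with
  | [::] => [::]
  | a :: l' => [set j : 'I_n | (off <= j < off + a)%N] :: blocks_from (off + a) l'
  end.

(* P_lambda^alpha (coordinate 1 of the paper is the index 0 here) *)
Definition P_lambda (lam : seq nat) (alpha : quat R) : qset :=
  P_triple [set j : 'I_n | (sumn lam <= j)%N] (blocks_from 0 lam)
    (fun j => if val j == 0%N then alpha else 1).

Definition parabolic_reps (I : Type) (J : I -> Prop) (F : I -> qset) :=
  [/\ forall i, J i -> parabolic (F i),
      forall P, parabolic P -> exists i, J i /\ Gconjugate P (F i) &
      forall i j, J i -> J j -> Gconjugate (F i) (F j) -> i = j].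
End Parabolic.

Definition is_partition (lam : seq nat) (m : nat) :=
  [/\ sorted geq lam, all (fun x => 0 < x)%N lam & sumn lam = m].

Definition gcd_parts (lam : seq nat) : nat := \big[gcdn/0%N]_(x <- lam) x.

Arguments P_lambda [R] K H n lam alpha _.
Arguments parabolic_reps [R] K H n [I] J F.
Arguments Gn [R] K H n _.
Arguments parabolic [R] K H n P.
Arguments Gconjugate [R] K H n P Q.

(* Main.v *)
(* A subset X of H^n splits the coordinates into the set I_0 where all of X
   vanishes and the classes on which the coordinate functions are proportional
   by elements of K; a monomial matrix fixes X pointwise iff it permutes each
   class and has the forced coefficients xi(j) / xi(s(j)) there, so every
   parabolic subgroup comes from a triple (I_0, Pi, xi).  Conjugation by a
   monomial matrix with coefficients a permutes the coordinates and multiplies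
   xi on the left by a, whose total product lies in H; as H <> 1, the subgroup
   determines I_0, Pi, and xi up to a right factor c_i on each block I_i.  So if I_0
   is empty the only invariant besides the block sizes is the class of
   prod_j xi(j) in the abelian group K/H modulo the products of the
   c_i^|I_i|, that is, by Bezout, modulo gcd(lambda)-th powers; if I_0 is
   nonempty, a coefficient there can absorb any product.  It remains to choose
   representatives of (K/H) modulo gcd(lambda)-th powers. *)
Require Import Defs.
From HB Require Import structures.
From mathcomp Require Import all_boot all_order all_algebra all_fingroup.
From mathcomp Require Import generic_quotient boolp reals finmap zify.
Import Order.TTheory GRing.Theory Num.Theory.
Local Open Scope ring_scope.
Set Implicit Arguments. Unset Strict Implicit. Unset Printing Implicit Defensive.

(** * Partitions and block sizes *)

(* The convention [block_index lam j = size lam] for [sumn lam <= j] makes I_0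
   the fibre over [size lam]. *)
Fixpoint block_index (lam : seq nat) (j : nat) : nat :=
  if lam is a :: lam' then
    if (j < a)%N then 0%N else (block_index lam' (j - a)).+1
  else 0%N.

Lemma block_index_lt lam j : (block_index lam j < size lam)%N = (j < sumn lam)%N.
Proof.
elim: lam j => [|a lam IH] j //=; case: (ltnP j a) => ja /=; first by lia.
by rewrite ltnS IH ltn_subLR.
Qed.

Lemma block_index_le lam j : (block_index lam j <= size lam)%N.
Proof. by elim: lam j => [|a lam IH] j //=; case: ifP => //=; rewrite ltnS. Qed.

Lemma block_index_top lam j : (block_index lam j == size lam) = (sumn lam <= j)%N.
Proof. by rewrite leqNgt -block_index_lt ltn_neqAle block_index_le andbT negbK. Qed.

(** The labels unfold one part at a time, which drives the inductions on [lam] that run over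
    coordinates. *)
Lemma map_block_index_cons a lam m : (a <= m)%N ->
  map (block_index (a :: lam)) (iota 0 m) =
  nseq a 0%N ++ map succn (map (block_index lam) (iota 0 (m - a)%N)).
Proof.
move=> am; apply: (@eq_from_nth _ 0%N) => [|j].
  by rewrite size_cat !size_map size_nseq !size_iota subnKC.
rewrite size_map size_iota => jm; rewrite (nth_map 0%N) ?size_iota // nth_iota //=.
rewrite nth_cat size_nseq; case: ltnP => ja; first by rewrite nth_nseq ja.
have jma : (j - a < m - a)%N by lia.
by rewrite -map_comp (nth_map 0%N) ?size_iota //= nth_iota.
Qed.

(** The appended entry [m - sumn lam] is the size of I_0, whose label is [size lam]. *)
Lemma count_block_index lam m i : (sumn lam <= m)%N ->
  count_mem i (map (block_index lam) (iota 0 m)) = nth 0%N (rcons lam (m - sumn lam)%N) i.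
Proof.
elim: lam m i => [|a lam IH] m i /= le_m.
  rewrite subn0 count_map; case: i => [|i] /=.
    by rewrite (eq_count (a2 := predT)) // count_predT size_iota.
  by rewrite nth_nil (eq_count (a2 := pred0)) // count_pred0.
have [am lm] : (a <= m)%N /\ (sumn lam <= m - a)%N by lia.
rewrite map_block_index_cons // count_cat count_nseq.
case: i => [|i] /=; rewrite count_map.
  by rewrite (eq_count (a2 := pred0)) // count_pred0 mul1n addn0.
by rewrite mul0n add0n subnDA -IH.
Qed.

Lemma sum_block_index (V : zmodType) lam m (F : nat -> V) : sumn lam = m ->
  \sum_(j < m) F (block_index lam j) = \sum_(i < size lam) F i *+ nth 0%N lam i.
Proof.
move=> <-; rewrite -(big_mkord xpredT (fun j => F (block_index lam j))).
rewrite /index_iota subn0 -(big_map (block_index lam) xpredT).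
elim: lam F => [|a lam IH] F; first by rewrite !big_nil big_ord0.
rewrite big_ord_recl map_block_index_cons /= ?leq_addr // big_cat addKn.
by rewrite big_nseq iter_addr_0 /= big_map (IH (F \o succn)).
Qed.

Lemma gcd_parts_cons a lam : gcd_parts (a :: lam) = gcdn a (gcd_parts lam).
Proof. by rewrite /gcd_parts big_cons. Qed.

(** Bezout with group elements as coefficients. Together with [gcd_parts_multiple] it identifies the
    products of the c_i^|I_i| with the gcd(lambda)-th powers. *)
Lemma gcd_parts_bezout (V : zmodType) lam (x : V) :
  exists F : nat -> V, \sum_(i < size lam) F i *+ nth 0%N lam i = x *+ gcd_parts lam.
Proof.
elim: lam x => [|a lam IH] x.
  by exists (fun=> 0); rewrite /gcd_parts big_nil big_ord0.
rewrite gcd_parts_cons; have [->|a0] := posnP a.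
  (* A zero part contributes nothing whatever value it carries, so [F] is merely shifted by one. *)
  have [F EF] := IH x; exists (fun i => F i.-1).
  by rewrite big_ord_recl /= mulr0n add0r gcd0n.
case: (egcdnP (gcd_parts lam) a0) => u v uv _.
(* The natural Bezout coefficients satisfy [u * a = v * gcd_parts lam + gcdn a (gcd_parts lam)]; the
   surplus is cancelled by a negative in [V]. *)
have [F EF] := IH (- (x *+ v)).
exists (fun i => if i is i'.+1 then F i' else x *+ u).
rewrite big_ord_recl /= EF mulNrn -!mulrnA uv mulrnDr addrC addKr //.
Qed.

Lemma dvdn_gcd_parts lam i : (gcd_parts lam %| nth 0 lam i)%N.
Proof.
elim: lam i => [|a lam IH] i; first by rewrite nth_nil dvdn0.
rewrite gcd_parts_cons; case: i => [|i] /=; first exact: dvdn_gcdl.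
exact: dvdn_trans (dvdn_gcdr _ _) (IH i).
Qed.

Lemma gcd_parts_multiple (V : zmodType) lam (F : nat -> V) :
  exists x, \sum_(i < size lam) F i *+ nth 0%N lam i = x *+ gcd_parts lam.
Proof.
exists (\sum_(i < size lam) F i *+ (nth 0%N lam i %/ gcd_parts lam)).
rewrite -sumrMnl; apply: eq_bigr => i _.
by rewrite -mulrnA divnK // dvdn_gcd_parts.
Qed.

Lemma sumn_count_mem (T : eqType) (L S : seq T) : uniq L ->
  sumn [seq count_mem x S | x <- L] = count [in L] S.
Proof.
elim: L => [|x L IH] /=; first by rewrite (eq_count (a2 := pred0)) ?count_pred0.
case/andP=> xL /IH ->; rewrite -count_predUI [count (predI _ _) _](_ : _ = 0%N).
  by rewrite addn0; apply: eq_count => y; rewrite /= inE.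
rewrite (eq_count (a2 := pred0)) ?count_pred0 // => y /=.
by apply/negbTE; apply: contra xL => /andP[/eqP->].
Qed.

(** The labels other than [d] are listed by decreasing multiplicity; the multiplicities form [lam],
    and a label is renamed to its position. Since [index] returns the length for an absent element,
    [d] is renamed to [size lam]. *)
Lemma partition_of_labels (S : seq nat) (d : nat) : exists lam (f : nat -> nat),
  [/\ is_partition lam (sumn lam), (sumn lam <= size S)%N,
      {in S &, injective f}, {in S, forall x, (f x == size lam) = (x == d)} &
      perm_eq (map (block_index lam) (iota 0 (size S))) (map f S)].
Proof.
pose cnt x := count_mem x S.
pose L := sort (relpre cnt geq) [seq x <- undup S | x != d].
have L_uniq : uniq L by rewrite sort_uniq filter_uniq ?undup_uniq.
have in_L x : (x \in L) = (x != d) && (x \in S).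
  by rewrite mem_sort mem_filter mem_undup.
pose lam := map cnt L; have lam_sum := sumn_count_mem S L_uniq.
exists lam, (index^~ L); split.
- split=> //; last first.
    rewrite all_map; apply/allP => x; rewrite in_L => /andP[_ xS] /=.
    by rewrite -has_count has_pred1.
  rewrite /lam sorted_map; apply: sort_sorted => x y /=.
  exact: leq_total.
- by rewrite [sumn lam]lam_sum count_size.
- move=> x y xS yS /= e.
  have [xL|xL] := boolP (x \in L).
    have := xL; rewrite -index_mem e index_mem => yL.
    by rewrite -(nth_index 0%N xL) e nth_index.
  have yL : y \notin L by rewrite -index_mem -e index_mem.
  move: xL yL; rewrite !in_L xS yS !andbT !negbK => /eqP-> /eqP-> //.
- move=> x xS; rewrite size_map eqn_leq index_size leqNgt index_mem in_L xS andbT.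
  by rewrite negbK.
(* Multiplicities are compared value by value: a position in the list, a value beyond its length,
   and the length itself, which collects the occurrences of [d]. *)
apply/allP => i _ /=; rewrite count_block_index; last by rewrite [sumn lam]lam_sum count_size.
rewrite count_map nth_rcons size_map; case: ltngtP => iL.
- rewrite (nth_map 0%N) //; apply/eqP/eq_in_count => x xS /=.
  apply/eqP/eqP => [->|e]; first by rewrite index_uniq.
  by rewrite -e nth_index // -index_mem e.
- rewrite (eq_count (a2 := pred0)) ?count_pred0 // => x /=; apply/negbTE.
  by rewrite neq_ltn (leq_ltn_trans (index_size _ _) iL).
rewrite iL [sumn lam]lam_sum -(count_predC [in L] S) addKn.
apply/eqP/eq_count => x /=.
by rewrite eqn_leq index_size leqNgt index_mem.
Qed.

(** Labels matter only through their fibres, so labellings are compared up to renaming, with the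
    fibres for I_0 matched. *)
Definition same_blocks n (l : 'I_n -> nat) d (l' : 'I_n -> nat) d' :=
  (forall i, (l i == d) = (l' i == d')) /\ forall i j, (l i == l j) = (l' i == l' j).

Definition blocks_of n lam : 'I_n -> nat := fun j => block_index lam j.

Lemma partition_of_blocks n (l : 'I_n -> nat) d : exists lam (t : 'S_n),
  [/\ is_partition lam (sumn lam), (sumn lam <= n)%N &
      same_blocks (l \o t) d (@blocks_of n lam) (size lam)].
Proof.
pose S := map l (enum 'I_n).
have szS : size S = n by rewrite size_map size_enum_ord.
have [lam [f [lamP lam_n f_inj f_top]]] := partition_of_labels S d.
rewrite szS in lam_n *; rewrite -map_comp.
pose T := [tuple of map (f \o l) (ord_tuple n)].
rewrite (_ : map (f \o l) (enum 'I_n) = T); last by congr map; apply: esym; apply: val_ord_tuple.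
(* Label sequences with equal multiplicities differ by a permutation [t] of the coordinates. *)
case/tuple_permP => t tE; exists lam, t.
have inS i : l i \in S by apply: map_f; rewrite mem_enum.
have E (i : 'I_n) : block_index lam i = f (l (t i)).
  have := congr1 (fun s => nth 0%N s i) tE; rewrite (nth_map 0%N) ?size_iota //.
  rewrite nth_iota // add0n => ->.
  by rewrite -tnth_nth tnth_mktuple tnth_map tnth_ord_tuple.
split=> //; split=> [i|i j]; rewrite /blocks_of !E /=; first by rewrite f_top.
by apply/eqP/eqP => [->|/f_inj->].
Qed.

(** The value 0 on I_0 keeps that set from being mistaken for a block of the same size. *)
Definition block_size n (l : 'I_n -> nat) d j : nat :=
  if l j == d then 0%N else count (fun i => l i == l j) (enum 'I_n).

Lemma same_block_size n (l : 'I_n -> nat) d l' d' :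
  same_blocks l d l' d' -> block_size l d =1 block_size l' d'.
Proof.
by case=> ed e j; rewrite /block_size ed; under eq_count do rewrite e.
Qed.

Lemma perm_map_enum n (t : 'S_n) : perm_eq (map t (enum 'I_n)) (enum 'I_n).
Proof.
apply: uniq_perm; rewrite ?(map_inj_uniq (@perm_inj _ t)) ?enum_uniq // => i.
by rewrite [RHS]mem_enum -[i](permKV t) map_f // mem_enum.
Qed.

Lemma block_size_comp n (l : 'I_n -> nat) d (t : 'S_n) j :
  block_size (l \o t) d j = block_size l d (t j).
Proof.
rewrite /block_size /=; case: ifP => // _.
rewrite -[LHS](count_map t (fun i => l i == l (t j))).
by have /seq.permP-> := perm_map_enum t.
Qed.

Lemma block_size_partition n lam j : (sumn lam <= n)%N ->
  block_size (@blocks_of n lam) (size lam) j = nth 0%N lam (block_index lam j).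
Proof.
move=> lam_n; rewrite /block_size /blocks_of.
case: eqP => [->|/eqP nj]; first by rewrite nth_default.
rewrite -(count_map (fun i : 'I_n => block_index lam i) (pred1 (block_index lam j))).
rewrite (map_comp (block_index lam) val) val_enum_ord count_block_index //.
by rewrite nth_rcons ltn_neqAle nj block_index_le.
Qed.

(** Each part equal to [a] accounts for [a] coordinates lying in a block of size [a]. *)
Lemma count_block_size lam n a : (0 < a)%N -> (sumn lam <= n)%N ->
  count_mem a [seq nth 0%N lam (block_index lam j) | j <- iota 0 n] =
  (a * count_mem a lam)%N.
Proof.
move=> a0; rewrite (map_comp (nth 0%N lam) (block_index lam)).
elim: lam n => [|b lam IH] n lam_n.
  rewrite muln0 -map_comp count_map (eq_count (a2 := pred0)) ?count_pred0 // => j /=.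
  by rewrite lt0n eq_sym in a0; apply/negbTE.
have [bn ln] : (b <= n)%N /\ (sumn lam <= n - b)%N by move: lam_n => /=; lia.
rewrite map_block_index_cons // map_cat -map_comp count_cat map_nseq count_nseq.
rewrite [X in (_ + X)%N](IH _ ln) /= mulnDr; congr (_ + _)%N.
by case: eqP => [->|_]; rewrite ?mul0n ?muln0 ?mul1n ?muln1.
Qed.

(** The multiset of block sizes over all coordinates is invariant under permutation; dividing the
    count of [a] by [a] recovers the multiplicity of each positive part, and a sorted list is
    determined by its multiplicities. *)
Lemma same_partition n lam mu (t : 'S_n) :
  is_partition lam (sumn lam) -> is_partition mu (sumn mu) ->
  (sumn lam <= n)%N -> (sumn mu <= n)%N ->
  same_blocks (@blocks_of n lam \o t) (size lam) (@blocks_of n mu) (size mu) -> lam = mu.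
Proof.
move=> [lam_s lam_pos _] [mu_s mu_pos _] lam_n mu_n e.
apply: (sorted_eq (leT := geq)) => //; first by move=> x y z /=; lia.
  by move=> x y /=; lia.
apply/allP => a _ /=; have [->|a0] := posnP a.
  have c0 (s : seq nat) : all (fun x => 0 < x)%N s -> count_mem 0%N s = 0%N.
    by move/allP => s0; apply/count_memPn/negP => /s0.
  by rewrite !c0.
rewrite -(eqn_pmul2l a0) -!(count_block_size a0 (n := n)) //.
have E nu : (sumn nu <= n)%N -> [seq nth 0%N nu (block_index nu j) | j <- iota 0 n] =
    [seq block_size (@blocks_of n nu) (size nu) j | j <- enum 'I_n].
  move=> nu_n; rewrite -val_enum_ord -map_comp; apply: eq_map => j /=.
  by rewrite block_size_partition.
rewrite !E // -(eq_map (same_block_size e)).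
rewrite (eq_map (block_size_comp _ _ t)) (map_comp _ t).
by have /(perm_map (block_size (@blocks_of n lam) (size lam)))/seq.permP-> := perm_map_enum t.
Qed.

(** * The abelian group K/H *)

Section AbelianQuotient.
Variables (R : realFieldType) (K H : {fset quat R}).
Hypotheses (K_group : is_qsubgroup K) (H_normal : normal_in H K).
Hypothesis (K_comm : commutators_in K H).

Lemma K1 : 1 \in K. Proof. by case: K_group. Qed.
Lemma KM x y : x \in K -> y \in K -> x * y \in K.
Proof. by case: K_group => _ M _; apply: M. Qed.
Lemma K_unit x : x \in K -> x \is a GRing.unit.
Proof. by case: K_group => _ _ V /V[]. Qed.
Lemma KV x : x \in K -> x^-1 \in K.
Proof. by case: K_group => _ _ V /V[]. Qed.
Lemma H_group : is_qsubgroup H. Proof. by case: H_normal. Qed.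
Lemma H1 : 1 \in H. Proof. by case: H_group. Qed.
Lemma HM x y : x \in H -> y \in H -> x * y \in H.
Proof. by case: H_group => _ M _; apply: M. Qed.
Lemma HV x : x \in H -> x^-1 \in H.
Proof. by case: H_group => _ _ V /V[]. Qed.
Lemma HK x : x \in H -> x \in K.
Proof. by case: H_normal => _ /fsubsetP s _; apply: s. Qed.
Lemma KX x m : x \in K -> x ^+ m \in K.
Proof. by move=> xK; elim: m => [|m IH]; rewrite ?expr0 ?K1 // exprS KM. Qed.

Hint Resolve K1 : core.

Definition coset_rel : rel K := fun x y => (fsval x)^-1 * fsval y \in H.

Lemma coset_rel_refl : reflexive coset_rel.
Proof. by move=> x; rewrite /coset_rel mulVr ?H1 // K_unit // fsvalP. Qed.

Lemma coset_rel_trans : transitive coset_rel.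
Proof.
move=> y x z xy yz; have := HM xy yz.
by rewrite mulrA mulrK // K_unit // fsvalP.
Qed.

Lemma coset_rel_sym : symmetric coset_rel.
Proof.
suff h x y : coset_rel x y -> coset_rel y x by move=> x y; apply/idP/idP; apply: h.
move=> /HV; rewrite invrM ?unitrV ?K_unit ?fsvalP // invrK; exact.
Qed.

Canonical coset_equiv :=
  EquivRel coset_rel coset_rel_refl coset_rel_sym coset_rel_trans.
(** The quotient is made a [zmodType] below, commutative because [K,K] lies in H. Conditions on
    ordered quaternion products thereby become conditions on sums. *)
Definition KH := {eq_quot coset_equiv}%qT.
HB.instance Definition _ := Choice.on KH.

(** Total on quaternions: an element outside [K] is sent to the class of 1, whence the membership
    premises in the rules for [cls]. *)
Definition cls (x : quat R) : KH := (\pi_({eq_quot coset_equiv}) (insubd (FSetSub K1) x))%qT.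
Definition rep (z : KH) : quat R := fsval (repr z).

Lemma cls_eq x y : x \in K -> y \in K -> (cls x == cls y) = (x^-1 * y \in H).
Proof. by move=> xK yK; rewrite eqmodE /= /coset_rel !insubdK. Qed.

Lemma repK z : rep z \in K. Proof. exact: fsvalP. Qed.

Lemma repP z : cls (rep z) = z.
Proof.
rewrite /cls /rep; have -> : insubd (FSetSub K1) (fsval (repr z)) = repr z.
  by apply: val_inj; rewrite insubdK // fsvalP.
exact: reprK.
Qed.

Definition KH_add (z w : KH) := cls (rep z * rep w).
Definition KH_opp (z : KH) := cls (rep z)^-1.

Lemma KH_addE x y : x \in K -> y \in K -> KH_add (cls x) (cls y) = cls (x * y).
Proof.
move=> xK yK; apply/eqP; rewrite /KH_add cls_eq ?KM ?repK //.
have := repP (cls x); have := repP (cls y).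
move: (repK (cls x)) (repK (cls y)); move: (rep _) (rep _) => x' y' x'K y'K.
move=> /eqP; rewrite cls_eq // => yy /eqP; rewrite cls_eq // => xx.
rewrite invrM ?K_unit // -mulrA (mulrA (x'^-1)).
(* Normality enters through y'^-1 x'^-1 x y = (y'^-1 y) (y^-1 (x'^-1 x) y). *)
case: H_normal => _ _ /(_ y^-1 _ (KV yK) xx); rewrite invrK => N.
have := HM yy N; rewrite !mulrA mulrK ?K_unit //.
Qed.

Lemma clsC x y : x \in K -> y \in K -> cls (x * y) = cls (y * x).
Proof.
move=> xK yK; apply/eqP; rewrite cls_eq ?KM ?repK //.
by rewrite invrM ?K_unit // !mulrA; apply: K_comm.
Qed.

Lemma KH_addC : commutative KH_add.
Proof. by move=> z w; apply: clsC; rewrite repK. Qed.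

Lemma KH_addA : associative KH_add.
Proof.
move=> x y z; rewrite -(repP x) -(repP y) -(repP z).
by rewrite !KH_addE ?mulrA ?KM ?repK.
Qed.

Lemma KH_add0 : left_id (cls 1) KH_add.
Proof. by move=> x; rewrite -(repP x) KH_addE ?repK // mul1r. Qed.

Lemma KH_addN : left_inverse (cls 1) KH_opp KH_add.
Proof.
move=> x; rewrite /KH_opp -{2}(repP x) KH_addE ?KV ?repK //.
by rewrite mulVr // K_unit // repK.
Qed.

HB.instance Definition _ :=
  GRing.isZmodule.Build KH KH_addA KH_addC KH_add0 KH_addN.

Lemma cls1 : cls 1 = 0. Proof. by []. Qed.

Lemma clsM x y : x \in K -> y \in K -> cls (x * y) = cls x + cls y.
Proof. by move=> xK yK; rewrite -KH_addE. Qed.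

Lemma clsV x : x \in K -> cls x^-1 = - cls x.
Proof.
move=> xK; apply/eqP; rewrite -addr_eq0 -clsM ?KV //.
by rewrite mulVr ?K_unit // cls1.
Qed.

Lemma cls_div x y : x \in K -> y \in K -> cls (x / y) = cls x - cls y.
Proof. by move=> xK yK; rewrite clsM ?KV // clsV. Qed.

Lemma clsX x m : x \in K -> cls (x ^+ m) = cls x *+ m.
Proof.
move=> xK; elim: m => [|m IH]; first by rewrite expr0 cls1.
by rewrite exprS clsM ?KX // IH mulrS.
Qed.

Lemma cls_eq0 x : x \in K -> (cls x == 0) = (x \in H).
Proof. by move=> xK; rewrite eq_sym -cls1 cls_eq // invr1 mul1r. Qed.

Lemma cls_H h : h \in H -> cls h = 0.
Proof. by move=> hH; apply/eqP; rewrite cls_eq0 // HK. Qed.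

Lemma K_prod (I : Type) (r : seq I) (P : pred I) (k : I -> quat R) :
  (forall i, P i -> k i \in K) -> \prod_(i <- r | P i) k i \in K.
Proof. by move=> kK; elim/big_rec: _ => // i x Pi xK; rewrite KM ?kK. Qed.

Lemma cls_prod (I : Type) (r : seq I) (P : pred I) (k : I -> quat R) :
  (forall i, P i -> k i \in K) ->
  cls (\prod_(i <- r | P i) k i) = \sum_(i <- r | P i) cls (k i).
Proof.
move=> kK; elim: r => [|i r IH]; first by rewrite !big_nil.
by rewrite !big_cons; case: ifP => // Pi; rewrite clsM ?kK ?K_prod // IH.
Qed.

Lemma prod_in_H (I : Type) (r : seq I) (P : pred I) (k : I -> quat R) :
  (forall i, P i -> k i \in K) ->
  (\prod_(i <- r | P i) k i \in H) = (\sum_(i <- r | P i) cls (k i) == 0).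
Proof. by move=> kK; rewrite -cls_prod // cls_eq0 ?K_prod. Qed.

(** * Monomial matrices *)

Section Monomial.
Variable n : nat.
Implicit Types (k : 'I_n -> quat R) (s : 'S_n) (I : {set 'I_n}).

(** Row [i] has its only entry [k i] in column [s i]; permutations compose from left to right, so
    products of matrices and of permutations come in the same order. *)
Definition mono k s : 'M[quat R]_n := diagq k *m perm_mx s.

Lemma mono_mulmxE k s m (A : 'M_(n, m)) i j :
  (mono k s *m A) i j = k i * A (s i) j.
Proof. by rewrite /mono /diagq -mulmxA -row_permE mul_diag_mx !mxE. Qed.

Lemma monoE k s i j : mono k s i j = k i * (s i == j)%:R.
Proof. by rewrite -[mono k s]mulmx1 mono_mulmxE mxE. Qed.

Lemma monoM k s k' s' :
  mono k s *m mono k' s' = mono (fun i => k i * k' (s i)) (s * s')%g.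
Proof. by apply/matrixP => i j; rewrite mono_mulmxE !monoE permM mulrA. Qed.

Lemma mono1 : mono (fun=> 1) 1%g = 1%:M.
Proof. by apply/matrixP => i j; rewrite monoE mxE perm1 mul1r. Qed.

Lemma eq_mono k k' s : k =1 k' -> mono k s = mono k' s.
Proof. by move=> e; apply/matrixP => i j; rewrite !monoE e. Qed.

Lemma mono_inj k s k' s' : (forall i, k i != 0) -> mono k s = mono k' s' ->
  s = s' /\ k =1 k'.
Proof.
move=> k0 e.
have E i j : k i * (s i == j)%:R = k' i * (s' i == j)%:R by rewrite -!monoE e.
have ss i : s' i = s i.
  apply/eqP; apply: contraT => ne; have := E i (s i).
  by rewrite eqxx (negbTE ne) mulr0 mulr1 => k00; have := k0 i; rewrite k00 eqxx.
split; first by apply/permP => i.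
by move=> i; have := E i (s i); rewrite ss eqxx !mulr1.
Qed.

Definition inv_coef k s : 'I_n -> quat R := fun i => (k ((s^-1)%g i))^-1.

Lemma monoVl k s : (forall i, k i \is a GRing.unit) ->
  mono (inv_coef k s) s^-1%g *m mono k s = 1%:M.
Proof.
move=> kU; rewrite monoM mulVg -mono1; apply: eq_mono => i.
by rewrite /inv_coef mulVr.
Qed.

Lemma monoVr k s : (forall i, k i \is a GRing.unit) ->
  mono k s *m mono (inv_coef k s) s^-1%g = 1%:M.
Proof.
move=> kU; rewrite monoM mulgV -mono1; apply: eq_mono => i.
by rewrite /inv_coef permK mulrV.
Qed.

Definition mono_on I k s := [/\ perm_on I s, forall j, j \in I -> k j \in K,
  forall j, j \notin I -> k j = 1 & \sum_(j in I) cls (k j) = 0].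

Lemma mono_on_K I k s j : mono_on I k s -> k j \in K.
Proof.
by case=> _ kK k1 _; have [/kK|/k1->] := boolP (j \in I); rewrite ?K1.
Qed.

Lemma mono_onM I k s k' s' : mono_on I k s -> mono_on I k' s' ->
  mono_on I (fun i => k i * k' (s i)) (s * s')%g.
Proof.
move=> g g'; case: (g) (g') => [ps kK k1 k0] [ps' kK' k1' k0']; split.
- exact: perm_onM.
- by move=> j _; apply: KM; [apply: mono_on_K g | apply: mono_on_K g'].
- by move=> j jI; rewrite k1 // (out_perm ps) // k1' // mulr1.
under eq_bigr do rewrite (clsM (mono_on_K _ g) (mono_on_K _ g')).
rewrite big_split /= k0 add0r -[RHS]k0' [RHS](reindex_inj (@perm_inj _ s)).
by apply: eq_bigl => j; rewrite (perm_closed _ ps).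
Qed.

Lemma mono_onV I k s : mono_on I k s -> mono_on I (inv_coef k s) s^-1%g.
Proof.
move=> g; case: (g) => [ps kK k1 k0]; have psV := perm_onV ps; split => //.
- by move=> j _; apply: KV; apply: mono_on_K g.
- by move=> j jI; rewrite /inv_coef (out_perm psV) // k1 // invr1.
under eq_bigr do rewrite (clsV (mono_on_K _ g)).
rewrite sumrN; apply/eqP; rewrite oppr_eq0; apply/eqP; rewrite -[RHS]k0.
rewrite [RHS](reindex_inj (@perm_inj _ s^-1%g)).
by apply: eq_bigl => j; rewrite (perm_closed _ psV).
Qed.

(** The monomial matrices with coefficient product in H contain the generators and are closed under
    products and inverses; conversely each is a diagonal generator times a permutation generator. *)
Lemma G_onP I g :
  G_on K H I g <-> exists k s, mono_on I k s /\ g = mono k s.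
Proof.
have one : mono_on I (fun=> 1) 1%g.
  by split=> //; [apply: perm_on1 | rewrite big1].
split.
  elim=> [|{}g g' Sg _ [k' [s' [G' ->]]]]; first by exists (fun=> 1), 1%g; rewrite mono1.
  suff [k [s [G ->]]] : exists k s, mono_on I k s /\ g = mono k s.
    by exists (fun i => k i * k' (s i)), (s * s')%g; rewrite monoM; split=> //; apply: mono_onM.
  have base h : A_gens K H I h \/ perm_gens I h ->
      exists k s, mono_on I k s /\ h = mono k s.
    case=> [[k [kK k1 kH ->]]|[s [ps ->]]].
      exists k, 1%g; rewrite /mono perm_mx1 mulmx1; split=> //; split=> //.
        exact: perm_on1.
      by apply/eqP; rewrite -prod_in_H.
    exists (fun=> 1), s; split; first by split=> //; rewrite big1.
    by rewrite /mono [X in X *m _](_ : _ = 1%:M) ?mul1mx // -mono1 /mono perm_mx1 mulmx1.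
  case: Sg => [/base //|[h [/base[k [s [G ->]]] [e _]]]].
  (* The inverse of a generator is known only by its defining equations; uniqueness of inverses
     gives it the explicit monomial form. *)
  exists (inv_coef k s), s^-1%g; split; first exact: mono_onV.
  have kU i : k i \is a GRing.unit by rewrite K_unit // (mono_on_K _ G).
  by rewrite -[LHS]mul1mx -(monoVl s kU) -mulmxA e mulmx1.
case=> k [s [[ps kK k1 k0] ->]]; rewrite -[mono k s]mulmx1 /mono -mulmxA.
apply: gen_mul; first by left; left; exists k; split=> //; rewrite prod_in_H // k0.
apply: gen_mul; last exact: gen_one.
by left; right; exists s.
Qed.

Definition monoG k := (forall j, k j \in K) /\ \sum_j cls (k j) = 0.

Lemma monoG_unit k j : monoG k -> k j \is a GRing.unit.
Proof. by case=> kK _; rewrite K_unit. Qed.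

Lemma GnP g : Gn K H n g <-> exists k s, monoG k /\ g = mono k s.
Proof.
rewrite /Gn G_onP; split=> -[k [s [G ->]]]; exists k, s; split=> //.
  split=> [j|]; first exact: mono_on_K G.
  by case: G => _ _ _ k0; rewrite -[RHS]k0; apply: eq_bigl => j; rewrite inE.
case: G => kK k0; split=> // [|j|]; [by apply/subsetP => j; rewrite inE|by rewrite inE|].
by rewrite -[RHS]k0; apply: eq_bigl => j; rewrite inE.
Qed.

End Monomial.

(** * Parabolic subgroups and their conjugates *)

Section Parabolics.
Variable n : nat.
Implicit Types (l : 'I_n -> nat) (d : nat) (xi k a : 'I_n -> quat R).
Implicit Types (s t : 'S_n).

Lemma sum_preim (P : pred 'I_n) (F : 'I_n -> KH) s :
  (forall j, P (s j) = P j) -> \sum_(j | P j) F (s j) = \sum_(j | P j) F j.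
Proof.
move=> Ps; rewrite [RHS](reindex_inj (@perm_inj _ s)).
by apply: eq_bigl => j; rewrite Ps.
Qed.

Lemma monoGV a t : monoG a -> monoG (inv_coef a t).
Proof.
case=> aK a0; split=> [j|]; first by rewrite KV.
under eq_bigr do rewrite clsV //.
by rewrite sumrN (sum_preim (fun j => cls (a j)) (P := predT)) // a0 oppr0.
Qed.

(** Off I_0 the coefficients are those of D_xi M(s) D_xi^-1; on I_0 they are free in [K] up to the
    product condition. *)
Definition in_block_group l d xi k s := [/\ forall j, l (s j) = l j,
  forall j, l j != d -> k j = xi j / xi (s j), forall j, l j = d -> k j \in K &
  \sum_(j | l j == d) cls (k j) = 0].

(* The parabolic subgroup of the triple whose set I_0 is the fibre of [l] over
   [d] and whose blocks are the other nonempty fibres of [l]. *)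
Definition block_group l d xi : 'M[quat R]_n -> Prop :=
  fun g => exists k s, in_block_group l d xi k s /\ g = mono k s.

Section Coefficients.
Variables (l : 'I_n -> nat) (d : nat) (xi : 'I_n -> quat R).
Hypothesis xiK : forall j, xi j \in K.

(** The classes of xi(j) / xi(s(j)) cancel in total because [s] permutes the coordinates off I_0.
    The product condition of the whole group thus reduces to the one on I_0. *)
Lemma block_sum0 k s : (forall j, l (s j) = l j) ->
  (forall j, l j != d -> k j = xi j / xi (s j)) ->
  \sum_(j | l j != d) cls (k j) = 0.
Proof.
move=> ls kE.
under eq_bigr => j jd do rewrite kE // cls_div //.
by rewrite sumrB (sum_preim (fun j => cls (xi j))) ?subrr // => j; rewrite ls.
Qed.

Lemma in_block_groupG k s : in_block_group l d xi k s -> monoG k.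
Proof.
case=> ls kE kK k0; split=> [j|]; last first.
  by rewrite (bigID (fun j => l j == d)) /= k0 add0r (block_sum0 ls).
by have [/eqP/kK//|/kE->] := boolP (l j == d); rewrite KM ?KV.
Qed.

(** The group is the pointwise stabilizer of the vectors [v i] with [i] different from [d], each
    equal to [xi] on one fibre and zero elsewhere. *)
Lemma block_group_parabolic : parabolic K H n (block_group l d xi).
Proof.
pose v i : 'cV[quat R]_n := \col_j (if l j == i then xi j else 0).
exists (fun w => exists i, i != d /\ w = v i); apply/funext => g; apply/propext; split.
  case=> k [s [ks ->]]; split.
    by apply/GnP; exists k, s; split=> //; apply: in_block_groupG ks.
  case: ks => ls kE _ _ _ [i [id ->]]; apply/colP => j.
  rewrite mono_mulmxE !mxE ls; case: eqP => [ji|_]; last by rewrite mulr0.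
  by rewrite kE ?ji // divrK // K_unit.
case=> /GnP[k [s [G ->]]] fix_v; exists k, s; split=> //.
have {}fix_v i j : i != d ->
    k j * (if l (s j) == i then xi (s j) else 0) = if l j == i then xi j else 0.
  move=> id; have := fix_v (v i) (ex_intro _ i (conj id erefl)).
  by move/colP/(_ j); rewrite mono_mulmxE !mxE.
have U j : k j \is a GRing.unit by apply: monoG_unit G.
have xi0 j : xi j != 0 by apply: K_unit.
(* As [xi] never vanishes, a fixed [v i] has its support preserved by [s]; the fibre over [d] is
   what remains. *)
have ls j : l (s j) = l j.
  have [jd|jd] := eqVneq (l j) d.
    have [->//|sjd] := eqVneq (l (s j)) d.
    have := fix_v _ j sjd; rewrite eqxx jd eq_sym (negbTE sjd) => /(congr1 ( *%R (k j)^-1)).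
    by rewrite mulrA mulVr // mul1r mulr0 => /eqP; rewrite (negbTE (xi0 _)).
  have := fix_v _ j jd; rewrite eqxx; case: eqP => [//|_].
  by rewrite mulr0 => /esym/eqP; rewrite (negbTE (xi0 _)).
have kE j : l j != d -> k j = xi j / xi (s j).
  move=> jd; have := fix_v _ j jd; rewrite ls eqxx => <-.
  by rewrite mulrK // K_unit.
case: G => kK; rewrite (bigID (fun j => l j == d)) /= (block_sum0 ls kE) addr0 => k0.
by split.
Qed.

End Coefficients.

Lemma parabolicP P : parabolic K H n P ->
  exists l d xi, (forall j, xi j \in K) /\ P = block_group l d xi.
Proof.
case=> X ->.
pose Z j := `[< forall v : 'cV[quat R]_n, X v -> v j 0 = 0 >].
pose e i j := `[< exists c, c \in K /\ forall v : 'cV[quat R]_n, X v -> v i 0 = c * v j 0 >].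
have e_refl i : e i i.
  by apply/asboolP; exists 1; rewrite K1; split=> // v; rewrite mul1r.
have e_sym i j : e i j -> e j i.
  case/asboolP => c [cK E]; apply/asboolP; exists c^-1; rewrite KV //; split=> // v Xv.
  by rewrite E // mulrA mulVr ?mul1r // K_unit.
have e_trans i j m : e i j -> e j m -> e i m.
  case/asboolP => c [cK E] /asboolP[c' [c'K E']].
  by apply/asboolP; exists (c * c'); rewrite KM //; split=> // v Xv; rewrite E // E' // mulrA.
(* Equivalent coordinates satisfy the same predicate [e], so [pick] chooses the same representative
   for them. *)
pose r j := odflt j [pick i | e j i].
have r_eq i j : e i j -> r i = r j.
  move=> ij; rewrite /r (@eq_pick _ (e i) (e j)).
    case: pickP => [//|] /(_ j) /=; rewrite e_refl //.
  by move=> m; apply/idP/idP; apply: e_trans => //; apply: e_sym.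
have r_in j : e j (r j) by rewrite /r; case: pickP => //= _; apply: e_refl.
have /choice[xi xiP] : forall j, exists c,
    c \in K /\ forall v : 'cV[quat R]_n, X v -> v j 0 = c * v (r j) 0.
  by move=> j; have /asboolP := r_in j.
have xiK j : xi j \in K by case: (xiP j).
have {}xiP j v : X v -> v j 0 = xi j * v (r j) 0 by case: (xiP j) => _; apply.
(* No ordinal below [n] has value [n], so this label is reserved for the coordinates vanishing on
   [X]. *)
pose l j := if Z j then n else r j : nat.
have ln j : (l j == n) = Z j by rewrite /l; case: (Z j); rewrite ?eqxx // ltn_eqF.
exists l, n, xi; split=> //; apply/funext => g; apply/propext; split.
  case=> /GnP[k [s [G ->]]] fixX; exists k, s; split=> //.
  have [kK ksum] := G; have U j : k j \is a GRing.unit by apply: monoG_unit G.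
  have {}fixX j v : X v -> v j 0 = k j * v (s j) 0.
    by move=> /fixX/colP/(_ j); rewrite mono_mulmxE.
  have es j : r j = r (s j).
    by apply/r_eq/asboolP; exists (k j); split=> // v; apply: fixX.
  have Zs j : Z (s j) = Z j.
    apply/asboolP/asboolP => z v Xv; first by rewrite fixX // z // mulr0.
    have := z v Xv; rewrite fixX // => /(congr1 ( *%R (k j)^-1)).
    by rewrite mulrA mulVr // mul1r mulr0.
  have ls j : l (s j) = l j by rewrite /l Zs -es.
  have kE j : l j != n -> k j = xi j / xi (s j).
    rewrite ln => /asboolP/existsNP[v /not_implyP[Xv /eqP vj]].
    (* Some [v] in [X] has a nonzero entry at [j], so its entry at the representative is invertible
       and cancels on the right. *)
    have w0 : v (r j) 0 \is a GRing.unit.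
      by apply: contra vj => /eqP w0; rewrite (xiP _ _ Xv) w0 mulr0.
    have := fixX j v Xv; rewrite (xiP j) // (xiP (s j)) // -es mulrA => /(mulIr w0) ->.
    by rewrite mulrK // K_unit.
  split=> //.
  by move: ksum; rewrite (bigID (fun j => l j == n)) /= (block_sum0 xiK ls kE) addr0.
case=> k [s [ks ->]]; split.
  by apply/GnP; exists k, s; split=> //; apply: in_block_groupG ks.
case: ks => ls kE _ _ v Xv; apply/colP => j; rewrite mono_mulmxE.
have [jn|jn] := eqVneq (l j) n.
  have z i : l i = n -> v i 0 = 0 by move/eqP; rewrite ln => /asboolP; apply.
  by rewrite !z ?ls // mulr0.
have := ls j; have := jn; rewrite kE // ln /l => Zj; rewrite (negbTE Zj).
(* If [Z (s j)] held, the ordinal [r j] would equal [n]; hence [j] and [s j] share their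
   representative. *)
case: ifP => [_ e1|_ /val_inj e1]; last first.
  by rewrite (xiP (s j)) // e1 mulrA divrK ?K_unit // -xiP.
by have := ltn_ord (r j); rewrite -e1 ltnn.
Qed.

Lemma mulmx_conjK (A B x : 'M[quat R]_n) :
  A *m B = 1%:M -> A *m (B *m x *m A) *m B = x.
Proof. by move=> AB; rewrite !mulmxA AB mul1mx -mulmxA AB mulmx1. Qed.

(** Conjugation by [mono a t] transports the labels along [t] and multiplies [xi] on the left by
    [a]. On I_0 the factors from [a] cancel in the sum of classes, since the conjugated permutation
    preserves that fibre. *)
Lemma conj_in_block_group l d xi a t p : (forall j, xi j \in K) -> monoG a ->
  block_group l d xi p ->
  block_group (l \o t) d (fun i => a i * xi (t i))
    (mono a t *m p *m mono (inv_coef a t) t^-1%g).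
Proof.
move=> xiK [aK a0] [k [s [[ls kE kK k0] ->]]].
exists (fun i => a i * k (t i) / a ((t * s * t^-1)%g i)), (t * s * t^-1)%g.
split; last by rewrite !monoM; apply: eq_mono => i; rewrite /inv_coef !permM.
have sE i : t ((t * s * t^-1)%g i) = s (t i) by rewrite !permM permKV.
split=> [j|j jd|j jd|] /=; first by rewrite sE ls.
- by rewrite kE // sE invrM ?K_unit // !mulrA.
- by rewrite KM ?KV // KM // kK.
under eq_bigr => j /eqP jd do rewrite cls_div ?clsM ?KM ?kK //.
rewrite sumrB big_split /= (sum_preim (fun j => cls (a j))); last by move=> j; rewrite sE ls.
rewrite [X in X - _]addrC addrK -[RHS]k0.
by rewrite [RHS](reindex_inj (@perm_inj _ t)).
Qed.

(** The reverse inclusion follows by conjugating with the inverse matrix, which undoes the change of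
    labels and of [xi]. *)
Lemma conj_block_group l d xi a t : (forall j, xi j \in K) -> monoG a ->
  (fun x => exists p, block_group l d xi p /\
     x = mono a t *m p *m mono (inv_coef a t) t^-1%g) =
  block_group (l \o t) d (fun i => a i * xi (t i)).
Proof.
move=> xiK aG; have aU j : a j \is a GRing.unit by apply: monoG_unit aG.
have [aK a0] := aG.
apply/funext => x; apply/propext; split=> [[p [Pp ->]]|Px].
  exact: conj_in_block_group.
have a'G : monoG (inv_coef a t) by apply: monoGV.
exists (mono (inv_coef a t) t^-1%g *m x *m mono a t); split; last first.
  by rewrite mulmx_conjK // monoVr.
have := @conj_in_block_group _ _ _ _ t^-1%g _ _ a'G Px.
rewrite invgK (_ : inv_coef (inv_coef a t) t^-1%g = a); last first.
  by apply/funext => i; rewrite /inv_coef invgK permK invrK.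
rewrite (_ : (l \o t) \o _ = l); last by apply/funext => i /=; rewrite permKV.
rewrite [X in block_group _ _ X](_ : _ = xi); last first.
  by apply/funext => i; rewrite permKV /inv_coef mulrA mulVr // mul1r.
by apply=> j; rewrite KM.
Qed.

Lemma Gconjugate_block_group l d xi Q : (forall j, xi j \in K) ->
  Gconjugate K H n (block_group l d xi) Q <->
  exists a t, monoG a /\ Q = block_group (l \o t) d (fun i => a i * xi (t i)).
Proof.
move=> xiK; split.
  case=> g [g' [/GnP[a [t [aG ->]]] _ _ e ->]]; exists a, t; split=> //.
  rewrite -conj_block_group //.
  suff -> : g' = mono (inv_coef a t) t^-1%g by [].
  have aU j : a j \is a GRing.unit by apply: monoG_unit aG.
  by rewrite -[LHS]mulmx1 -(monoVr t aU) mulmxA e mul1mx.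
case=> a [t [aG ->]]; have aU j : a j \is a GRing.unit by apply: monoG_unit aG.
exists (mono a t), (mono (inv_coef a t) t^-1%g); split.
- by apply/GnP; exists a, t.
- by apply/GnP; exists (inv_coef a t), t^-1%g; split=> //; apply: monoGV.
- exact: monoVr.
- exact: monoVl.
by rewrite conj_block_group.
Qed.

(** Equality of the ratios on a block says that [xi'] arises from [xi] by a right factor constant on
    that block. *)
Definition same_triple l d xi l' d' xi' := same_blocks l d l' d' /\
  forall i j, l i = l j -> l i != d -> xi i / xi j = xi' i / xi' j.

Lemma same_triple_sym l d xi l' d' xi' :
  same_triple l d xi l' d' xi' -> same_triple l' d' xi' l d xi.
Proof.
case=> -[ed e] x; split=> [|i j /eqP ij id]; first by split.
by apply/esym/x; [apply/eqP; rewrite e | rewrite ed].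
Qed.

Lemma same_triple_sub l d xi l' d' xi' g : same_triple l d xi l' d' xi' ->
  block_group l d xi g -> block_group l' d' xi' g.
Proof.
case=> -[ed e] x [k [s [[ls kE kK k0] ->]]]; exists k, s; split=> //.
have ls' j : l' (s j) = l' j by apply/eqP; rewrite -e ls.
split=> // [j jd|j /eqP|]; first by rewrite kE ?ed // x // ed.
  by rewrite -ed => /eqP; apply: kK.
by rewrite -[RHS]k0; apply: eq_bigl => j; rewrite ed.
Qed.

Hypothesis H_nontrivial : exists2 h, h \in H & h != 1.

(** Two kinds of test elements suffice: the transposition of [i] and [j] with coefficient xi(i) /
    xi(j), and a diagonal matrix with a single nontrivial entry from H. *)
Lemma block_group_sub l d xi l' d' xi' :
  (forall j, xi j \in K) -> (forall j, xi' j \in K) ->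
  (forall g, block_group l d xi g -> block_group l' d' xi' g) ->
  [/\ forall i, l i = d -> l' i = d', forall i j, l i = l j -> l i != d -> l' i = l' j &
  forall i j, l i = l j -> l i != d -> l' i != d' -> xi i / xi j = xi' i / xi' j].
Proof.
move=> xiK xi'K sub.
have aux k s : in_block_group l d xi k s -> in_block_group l' d' xi' k s.
  move=> ks; have [] := sub (mono k s); first by exists k, s.
  move=> k' [s' [ks' E]].
  have [j|-> /funext-> //] := mono_inj _ E.
  by have := monoG_unit j (in_block_groupG xiK ks).
have tr i j : l i = l j -> l i != d ->
    exists2 k, k i = xi i / xi j & in_block_group l' d' xi' k (tperm i j).
  move=> ij id; exists (fun m => if l m == d then 1 else xi m / xi (tperm i j m)).
    by rewrite (negbTE id) tpermL.
  apply: aux; split=> [m|m /negbTE-> //|m ->|]; first by case: tpermP => // ->.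
    by rewrite eqxx K1.
  by rewrite big1 // => m /eqP->; rewrite eqxx cls1.
split.
- move=> i id; apply/eqP; apply: contraT => i'd.
  have [h hH h1] := H_nontrivial.
  (* Outside I_0' the identity permutation forces coefficient 1. So h != 1 separates a coordinate of
     I_0 from a block, even a singleton one. *)
  have : in_block_group l d xi (fun m => if m == i then h else 1) 1%g.
    split=> [m|m md|m _|]; first by rewrite perm1.
    + rewrite perm1 mulrV ?K_unit //; case: eqP => // mi.
      by move: md; rewrite mi id eqxx.
    + by case: ifP => _; [apply: HK | apply: K1].
    rewrite big1 // => m _; case: ifP => _ //.
    by apply/eqP; rewrite cls_eq0 // HK.
  case/aux => _ /(_ i i'd); rewrite eqxx perm1 mulrV ?K_unit // => h1'.
  by rewrite h1' eqxx in h1.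
- by move=> i j ij id; have [k _ [/(_ i)]] := tr i j ij id; rewrite tpermL.
- move=> i j ij id i'd; have [k ki [_ /(_ i i'd)]] := tr i j ij id.
  by rewrite ki tpermL.
Qed.

Lemma block_group_eq l d xi l' d' xi' :
  (forall j, xi j \in K) -> (forall j, xi' j \in K) ->
  block_group l d xi = block_group l' d' xi' <-> same_triple l d xi l' d' xi'.
Proof.
move=> xiK xi'K; split=> [e|e]; last first.
  apply/funext => g; apply/propext; split; apply: same_triple_sub => //.
  exact: same_triple_sym.
have le12 g : block_group l d xi g -> block_group l' d' xi' g by rewrite e.
have le21 g : block_group l' d' xi' g -> block_group l d xi g by rewrite e.
have [d1 e1 x1] := block_group_sub xiK xi'K le12.
have [d2 e2 x2] := block_group_sub xi'K xiK le21.
have ed i : (l i == d) = (l' i == d') by apply/eqP/eqP; [apply: d1 | apply: d2].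
split=> [|i j ij id]; last by apply: x1 => //; rewrite -ed.
split=> // i j; apply/eqP/eqP => ij.
  by have [id|id] := eqVneq (l i) d; [rewrite !d1 -?ij | apply: e1].
by have [id|id] := eqVneq (l' i) d'; [rewrite !d2 -?ij | apply: e2].
Qed.

End Parabolics.

(** * Products of block factors and the standard parabolic subgroups *)

Section StandardParabolics.
Variable n : nat.
Implicit Types (I J : {set 'I_n}) (s t : 'S_n).

Lemma split_perm I s : (forall j, (s j \in I) = (j \in I)) ->
  exists s1 s2, [/\ perm_on I s1, forall j, j \in I -> s2 j = j,
    forall j, j \notin I -> s2 j = s j & s = (s1 * s2)%g].
Proof.
move=> sI; pose s1 := restr_perm I s; exists s1, (s1^-1 * s)%g.
have s1on : perm_on I s1 by apply: restr_perm_on.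
have sN : s \in 'N(I | 'P)%g by apply/astabsP => j; apply: sI.
split=> // [j jI|j jI|]; last by rewrite mulKVg.
  rewrite permM -(restr_permE sN) ?permKV // -(perm_closed _ s1on) permKV //.
by rewrite permM (out_perm (perm_onV s1on)).
Qed.

Lemma perm_fix_stable I s : (forall j, j \in I -> s j = j) ->
  forall j, (s j \in I) = (j \in I).
Proof.
move=> sI j; apply/idP/idP => [/[dup] /sI/perm_inj -> //|jI].
by rewrite sI.
Qed.

(** On disjoint blocks the permutations combine into a single one preserving every block, and the
    inner factors [delta (s1 j)] cancel between successive conjugates. *)
Lemma prod_blocksP (delta : 'I_n -> quat R) (Pi : seq {set 'I_n}) (g : 'M_n) :
  (forall j, delta j \is a GRing.unit) ->
  pairwise (fun A B : {set _} => [disjoint A & B]) Pi ->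
  prod_sets (map (fun I g => exists s : 'S_n, perm_on I s /\
    g = diagq delta *m perm_mx s *m diagq (fun j => (delta j)^-1)) Pi) g <->
  exists s, [/\ forall j, (forall I, I \in Pi -> j \notin I) -> s j = j,
    forall I, I \in Pi -> forall j, (s j \in I) = (j \in I) &
    g = mono (fun j => delta j / delta (s j)) s].
Proof.
move=> dU; elim: Pi g => [|I Pi IH] g.
  rewrite /=; split=> [->|[s [s1 _ ->]]].
    exists 1%g; split=> // [j _|]; first by rewrite perm1.
    by rewrite -mono1; apply: eq_mono => j; rewrite perm1 mulrV.
  have -> : s = 1%g by apply/permP => j; rewrite perm1 s1.
  by rewrite -mono1; apply: eq_mono => j; rewrite perm1 mulrV.
have diagE s : diagq delta *m perm_mx s *m diagq (fun j => (delta j)^-1) =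
    mono (fun j => delta j / delta (s j)) s.
  rewrite -[X in _ *m X](mulmx1 _) -perm_mx1 -/(mono _ _) -/(mono _ _).
  by rewrite monoM mulg1.
rewrite pairwise_cons => /andP[/allP/= dis /IH{}IH].
have dj J j : J \in Pi -> j \in I -> j \notin J.
  by move=> JP jI; rewrite (disjointFr (dis J JP) jI).
split.
  case=> a [b [[s1 [s1I ->]] /IH[s2 [s2fix s2st ->]] ->]].
  exists (s1 * s2)%g; split=> [j jn|J|].
  - rewrite permM (out_perm s1I) ?jn ?mem_head // s2fix // => J JP.
    by rewrite jn // inE JP orbT.
  - rewrite inE => /predU1P[->|JP] j; rewrite permM.
      rewrite perm_fix_stable ?(perm_closed _ s1I) // => i iI.
      by rewrite s2fix // => J' JP'; apply: dj.
    rewrite s2st //; have [jI|jI] := boolP (j \in I); last by rewrite (out_perm s1I).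
    by rewrite !(negbTE (dj _ _ JP _)) // (perm_closed _ s1I).
  - rewrite diagE monoM; apply: eq_mono => j.
    by rewrite permM mulrA divrK.
case=> s [sfix sst ->].
have [s1 [s2 [s1I s2I s2E sE]]] := split_perm (sst I (mem_head _ _)).
exists (mono (fun j => delta j / delta (s1 j)) s1), (mono (fun j => delta j / delta (s2 j)) s2).
split; first by exists s1; rewrite diagE.
  apply/IH; exists s2; split=> // [j jn|J JP j].
    have [/s2I //|jI] := boolP (j \in I); rewrite s2E // sfix // => J.
    by rewrite inE => /predU1P[->|/jn].
  have [/s2I-> //|jI] := boolP (j \in I); rewrite s2E // sst // inE JP orbT //.
rewrite monoM -sE; apply: eq_mono => j.
by rewrite sE permM mulrA divrK.
Qed.

(** A label-preserving permutation splits into its restriction to I_0 and a rest that fixes I_0. As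
    [delta] is 1 on I_0, the two families of coefficients do not interfere. *)
Lemma P_triple_block_group (l : 'I_n -> nat) d xi :
  (forall j, (l j <= d)%N) -> (forall j, xi j \in K) ->
  P_triple K H [set j | l j == d] [seq [set j | l j == i] | i <- iota 0 d] xi =
  block_group l d xi.
Proof.
move=> ld xiK; set I0 := [set j | _]; set Pi := map _ _.
pose delta j := if j \in I0 then 1 else xi j.
have dK j : delta j \in K by rewrite /delta; case: ifP => _; rewrite ?K1.
have dU j : delta j \is a GRing.unit by apply: K_unit.
have Pi_dis : pairwise (fun A B : {set 'I_n} => [disjoint A & B]) Pi.
  rewrite /Pi pairwise_map; have := iota_uniq 0 d; rewrite uniq_pairwise.
  apply: sub_pairwise => i i' /= ii'; rewrite disjoints_subset.
  by apply/subsetP => j; rewrite !inE => /eqP->.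
have inI0 j : (j \in I0) = (l j == d) by rewrite inE.
have dE j : l j != d -> delta j = xi j by rewrite /delta inI0 => /negbTE->.
have d1 j : l j = d -> delta j = 1 by rewrite /delta inI0 => ->; rewrite eqxx.
have inPi j : l j != d -> [set j' | l j' == l j] \in Pi.
  by move=> jd; apply: map_f; rewrite mem_iota /= add0n ltn_neqAle jd ld.
rewrite /P_triple /= -/delta.
rewrite (_ : (fun j => if _ then 1 else _) = (fun j => (delta j)^-1)); last first.
  by apply/funext => j; rewrite /delta; case: ifP; rewrite ?invr1.
apply/funext => g; apply/propext; split.
  case=> _ [_ [/G_onP[k1 [s1 [k1P ->]]] /(prod_blocksP _ dU Pi_dis)[s2 [s2f s2s ->]] ->]].
  have [s1I k1K k11 k1s] := k1P.
  have s2d j : l j = d -> s2 j = j.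
    move=> jd; apply: s2f => J /mapP[i]; rewrite mem_iota add0n => /= id ->.
    by rewrite inE jd gtn_eqF.
  have ls2 j : l (s2 j) = l j.
    have [/s2d-> //|jd] := eqVneq (l j) d.
    by have := s2s _ (inPi _ jd) j; rewrite !inE eqxx => /eqP.
  have s1n j : l j != d -> s1 j = j by move=> jd; rewrite (out_perm s1I) ?inI0.
  have ls1 j : l (s1 j) = l j.
    have [jd|/s1n-> //] := eqVneq (l j) d.
    by have := perm_closed j s1I; rewrite !inI0 jd eqxx => /eqP.
  exists (fun j => k1 j * (delta (s1 j) / delta (s2 (s1 j)))), (s1 * s2)%g.
  have kd j : l j = d -> k1 j * (delta (s1 j) / delta (s2 (s1 j))) = k1 j.
    by move=> jd; rewrite !d1 ?ls2 ?ls1 // divr1 mulr1.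
  rewrite monoM; split=> //; split=> [j|j jd|j jd|].
  - by rewrite permM ls2 ls1.
  - by rewrite permM s1n // !dE ?ls2 // k11 ?mul1r // inI0.
  - by rewrite kd // k1K // inI0 jd.
  rewrite -[RHS]k1s; apply: eq_big => j; first by rewrite inI0.
  by move/eqP => jd; rewrite kd.
case=> k [s [[ls kE kK k0] ->]].
have sI0 j : (s j \in I0) = (j \in I0) by rewrite !inI0 ls.
have [s1 [s2 [s1I s2I s2E sE]]] := split_perm sI0.
have s1n j : l j != d -> s1 j = j by move=> jd; rewrite (out_perm s1I) ?inI0.
have ls1 j : l (s1 j) = l j.
  have [jd|/s1n-> //] := eqVneq (l j) d.
  by have := perm_closed j s1I; rewrite !inI0 jd eqxx => /eqP.
have ls2 j : l (s2 j) = l j.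
  have [jd|jd] := eqVneq (l j) d; first by rewrite s2I ?inI0 ?jd.
  by rewrite s2E ?inI0.
exists (mono (fun j => if l j == d then k j else 1) s1), (mono (fun j => delta j / delta (s2 j)) s2).
split.
- apply/G_onP; exists (fun j => if l j == d then k j else 1), s1; split=> //; split=> //.
  + by move=> j; rewrite inI0 => /[dup] /eqP /kK kj ->.
  + by move=> j; rewrite inI0 => /negbTE->.
  rewrite -[RHS]k0; apply: eq_big => j; first by rewrite inI0.
  by rewrite inI0 => ->.
- apply/(prod_blocksP _ dU Pi_dis); exists s2; split=> //.
    move=> j jn; apply: s2I; rewrite inI0; apply/negPn/negP => jd.
    by have := jn _ (inPi _ jd); rewrite inE eqxx.
  by move=> J /mapP[i _ ->] j; rewrite !inE ls2.
rewrite monoM -sE; apply: eq_mono => j.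
have [jd|jd] := eqVneq (l j) d; first by rewrite !d1 ?ls2 ?ls1 // divr1 mulr1.
by rewrite s1n // !dE ?ls2 // mul1r kE // sE permM s1n.
Qed.

(** The condition [off <= j] is needed because the subtraction is truncated. *)
Lemma blocks_fromE off lam : @blocks_from n off lam =
  [seq [set j : 'I_n | (off <= j)%N && (block_index lam (j - off) == i)]
  | i <- iota 0 (size lam)].
Proof.
elim: lam off => [|a lam IH] off //=; rewrite IH; congr (_ :: _).
  apply/setP => j; rewrite !inE; case: (leqP off j) => oj //=.
  by rewrite -ltn_subLR //; case: ltnP.
rewrite (iotaDl 1 0) -map_comp; apply: eq_map => i /=; apply/setP => j; rewrite !inE.
case: (ltnP (j - off) a) => ja; first by rewrite andbF; case: leqP => //; lia.
rewrite add1n eqSS subnDA; case: (leqP (off + a) j) => aj; case: (leqP off j) => oj //=; lia.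
Qed.

Definition xi_of (alpha : quat R) : 'I_n -> quat R :=
  fun j => if val j == 0%N then alpha else 1.

Lemma P_lambdaE lam alpha : alpha \in K ->
  P_lambda K H n lam alpha = block_group (@blocks_of n lam) (size lam) (xi_of alpha).
Proof.
move=> aK; rewrite -P_triple_block_group.
- rewrite /P_lambda blocks_fromE; congr P_triple.
    by apply/setP => j; rewrite !inE block_index_top.
  by apply: eq_map => i; apply/setP => j; rewrite !inE subn0.
- by move=> j; apply: block_index_le.
- by move=> j; rewrite /xi_of; case: ifP; rewrite ?K1.
Qed.

End StandardParabolics.

(** * Classification *)

Section Classification.
Variable n : nat.
Hypothesis n_gt0 : (0 < n)%N.
Hypothesis H_nontrivial : exists2 h, h \in H & h != 1.
Implicit Types (l : 'I_n -> nat) (xi : 'I_n -> quat R) (t : 'S_n).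

Lemma xi_ofK alpha j : alpha \in K -> @xi_of n alpha j \in K.
Proof. by move=> aK; rewrite /xi_of; case: ifP; rewrite ?K1. Qed.

Lemma sum_xi_of alpha : \sum_j cls (@xi_of n alpha j) = cls alpha.
Proof.
rewrite (bigD1 (Ordinal n_gt0)) //= big1 ?addr0 // => j /negbTE j0.
by rewrite /xi_of (_ : (_ == _) = false).
Qed.

Lemma Gconjugate_P_lambda l d xi lam t a alpha : (forall j, xi j \in K) ->
  same_blocks (l \o t) d (@blocks_of n lam) (size lam) -> monoG a -> alpha \in K ->
  (forall i j : 'I_n, block_index lam i = block_index lam j ->
     block_index lam i != size lam ->
     (a i * xi (t i)) / (a j * xi (t j)) = xi_of alpha i / xi_of alpha j) ->
  Gconjugate K H n (block_group l d xi) (P_lambda K H n lam alpha).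
Proof.
move=> xiK [ed e] aG aK x; rewrite P_lambdaE //; apply/Gconjugate_block_group => //.
exists a, t; split=> //; have [aK' _] := aG.
apply/esym/block_group_eq => //; [by move=> j; rewrite KM|by move=> j; apply: xi_ofK|].
split=> // i j /eqP; rewrite e => /eqP ij; rewrite ed => id.
exact: x.
Qed.

(** The last coordinate lies in I_0, where [xi] is irrelevant. All other values of [xi] can
    therefore be normalised to 1. *)
Lemma Gconjugate_P_lambda1 l d xi lam t : (forall j, xi j \in K) ->
  same_blocks (l \o t) d (@blocks_of n lam) (size lam) -> (sumn lam < n)%N ->
  Gconjugate K H n (block_group l d xi) (P_lambda K H n lam 1).
Proof.
move=> xiK sb lam_n; have pn : (n.-1 < n)%N by rewrite prednK.
pose i0 := Ordinal pn.
(* This entry compensates the inverses of [xi] at the other coordinates, bringing the product into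
   H. *)
pose y := rep (\sum_(i | i != i0) cls (xi (t i))).
pose a i := if i == i0 then y else (xi (t i))^-1.
have aG : monoG a.
  split=> [j|]; first by rewrite /a; case: ifP => _; rewrite ?KV ?repK.
  rewrite (bigD1 i0) //= {1}/a eqxx repP -big_split big1 //= => i /negbTE ii0.
  by rewrite /a ii0 clsV ?addrN.
apply: (Gconjugate_P_lambda xiK sb aG) => [|i j ij id]; first exact: K1.
have top (k : 'I_n) : block_index lam k != size lam -> k != i0.
  by apply: contra => /eqP->; rewrite block_index_top /=; lia.
have xi1 (k : 'I_n) : xi_of 1 k = 1 by rewrite /xi_of; case: ifP.
by rewrite /a !ifN ?top -?ij // !mulVr ?K_unit // !xi1.
Qed.

Lemma Gconjugate_P_lambda_full l d xi lam t alpha x : (forall j, xi j \in K) ->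
  same_blocks (l \o t) d (@blocks_of n lam) (size lam) -> sumn lam = n ->
  alpha \in K -> \sum_j cls (xi j) = cls alpha + x *+ gcd_parts lam ->
  Gconjugate K H n (block_group l d xi) (P_lambda K H n lam alpha).
Proof.
move=> xiK sb lam_n aK xi_sum; have [F EF] := gcd_parts_bezout lam x.
(* The block factors c cancel in the subgroup but shift the class of the product by x *+ gcd. *)
pose c (i : 'I_n) := rep (F (block_index lam i)).
(* Chosen so that [a i * xi (t i)] is exactly [xi_of alpha i * c i]; the assumption on the sum of
   classes then puts the product of [a] in H. *)
pose a i := xi_of alpha i * c i / xi (t i).
have aG : monoG a.
  split=> [j|]; first by rewrite !KM ?KV ?repK // xi_ofK.
  under eq_bigr => i _ do rewrite cls_div ?KM ?repK ?xi_ofK // clsM ?repK ?xi_ofK // repP.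
  rewrite sumrB big_split /= sum_xi_of (sum_block_index F lam_n) EF.
  by rewrite (sum_preim (fun j => cls (xi j)) (P := predT)) // xi_sum subrr.
apply: (Gconjugate_P_lambda xiK sb aG) => // i j ij id.
have cU b : rep b \is a GRing.unit by rewrite K_unit ?repK.
by rewrite /a !divrK ?K_unit // /c ij invrM ?K_unit ?xi_ofK ?repK // mulrA mulrK.
Qed.

(** When I_0 is empty, the right factor [c] comparing the two functions xi is constant on every
    block. Summing its classes gives [cls alpha - cls beta] on one side and a multiple of the gcd on
    the other. *)
Lemma P_lambda_conj_inv lam mu alpha beta :
  is_partition lam (sumn lam) -> is_partition mu (sumn mu) ->
  (sumn lam <= n)%N -> (sumn mu <= n)%N -> alpha \in K -> beta \in K ->
  Gconjugate K H n (P_lambda K H n lam alpha) (P_lambda K H n mu beta) ->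
  lam = mu /\ (sumn lam = n -> exists x, cls alpha = cls beta + x *+ gcd_parts lam).
Proof.
move=> lamP muP lam_n mu_n aK bK; rewrite !P_lambdaE //.
have xaK (j : 'I_n) : xi_of alpha j \in K by apply: xi_ofK.
have xbK (j : 'I_n) : xi_of beta j \in K by apply: xi_ofK.
case/Gconjugate_block_group => // a [t [[a_K a0] /esym/block_group_eq[]//]].
  by move=> j; rewrite KM.
move=> sb x; have lam_mu := same_partition lamP muP lam_n mu_n sb; subst mu.
split=> // lamn.
pose c (i : 'I_n) := (xi_of beta i)^-1 * (a i * xi_of alpha (t i)).
have cc (i j : 'I_n) : block_index lam i = block_index lam j -> c i = c j.
  move=> ij; have jd : block_index lam j != size lam by rewrite block_index_top; have := ltn_ord j; lia.
  have [ed e] := sb; have := x i j; rewrite ed /blocks_of ij => h.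
  have {}h : a i * xi_of alpha (t i) / (a j * xi_of alpha (t j)) = xi_of beta i / xi_of beta j.
    by apply: h => //; apply/eqP; rewrite e /blocks_of ij.
  have U : a j * xi_of alpha (t j) \is a GRing.unit by rewrite K_unit // KM.
  rewrite /c -[a i * _](divrK U) h !mulrA mulVr ?mul1r // K_unit //.
(* The class of [c] is read off at any coordinate of the block; a label without coordinates gets
   0. *)
pose F b := if [pick i : 'I_n | block_index lam i == b] is Some i then cls (c i) else 0.
have FE i : cls (c i) = F (block_index lam i).
  rewrite /F; case: pickP => [j /eqP /cc-> //|/(_ i)]; by rewrite eqxx.
have [z Ez] := gcd_parts_multiple lam F; exists z; rewrite -Ez -(sum_block_index F lamn).
under eq_bigr => i _ do rewrite -FE clsM ?KV ?KM // clsV // clsM //.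
rewrite big_split sumrN sum_xi_of /= big_split /= a0 add0r addrA addrN add0r.
by rewrite (sum_preim (fun j => cls (xi_of alpha j)) (P := predT)) // sum_xi_of.
Qed.

(** Both cases of the classification reduce to this: for each partition of n, the first [bound lam]
    values of [r] must be a transversal of K/H modulo gcd(lambda)-th powers. As [r 0] is 1, index 0
    also serves the partitions of m < n. *)
Lemma parabolic_reps_of_transversal (r : nat -> quat R) (bound : seq nat -> nat) :
  r 0%N = 1 ->
  (forall lam s, is_partition lam n -> (s < bound lam)%N -> r s \in K) ->
  (forall lam z, is_partition lam n ->
     exists s x, (s < bound lam)%N /\ z = cls (r s) + x *+ gcd_parts lam) ->
  (forall lam s s' x, is_partition lam n -> (s < bound lam)%N -> (s' < bound lam)%N ->
     cls (r s) = cls (r s') + x *+ gcd_parts lam -> s = s') ->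
  parabolic_reps K H n
    (fun i : seq nat * nat =>
       (exists m, (m < n)%N /\ is_partition i.1 m /\ i.2 = 0%N)
       \/ (is_partition i.1 n /\ (i.2 < bound i.1)%N))
    (fun i => P_lambda K H n i.1 (r i.2)).
Proof.
move=> r0 rK r_ex r_uniq.
pose J (i : seq nat * nat) := (exists m, (m < n)%N /\ is_partition i.1 m /\ i.2 = 0%N)
       \/ (is_partition i.1 n /\ (i.2 < bound i.1)%N).
have JP i : J i -> [/\ r i.2 \in K, is_partition i.1 (sumn i.1) & (sumn i.1 <= n)%N].
  case=> [[m [mn [P ->]]]|[P ib]].
    by case: (P) => _ _ E; rewrite E r0 K1; split=> //; apply: ltnW.
  by have [_ _ E] := P; rewrite E; split=> //; apply: rK ib.
split=> [i /JP[iK _ _]|P|[lam s] [mu s'] Ji Jj].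
- by rewrite P_lambdaE //; apply: block_group_parabolic => j; apply: xi_ofK.
- case/parabolicP => l [d [xi [xiK ->]]].
  have [lam [t [lamP lam_n sb]]] := partition_of_blocks l d.
  have [lamn|lamn] := ltnP (sumn lam) n.
    exists (lam, 0%N); split; first by left; exists (sumn lam).
    by rewrite /= r0; apply: Gconjugate_P_lambda1 sb _.
  have lamE : sumn lam = n by apply/eqP; rewrite eqn_leq lam_n.
  rewrite lamE in lamP; have [s [x [sb' E]]] := r_ex _ (\sum_j cls (xi j)) lamP.
  exists (lam, s); split; first by right.
  by apply: (Gconjugate_P_lambda_full xiK sb lamE _ E); apply: rK sb'.
have [sK lamP lam_n] := JP _ Ji; have [sK' muP mu_n] := JP _ Jj.
case/P_lambda_conj_inv => //= lam_mu; subst mu => h; congr (_, _).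
case: Ji Jj => [[m [mn [[_ _ /= lm] /= ->]]]|[/= lamN sb]].
  case=> [[m' [_ [_ /= -> //]]]|[/= [_ _ lmn] _]].
  by move: mn; rewrite -lm lmn ltnn.
case=> [[m [mn [[_ _ /= lm] _]]]|[/= _ sb']].
  by case: lamN => _ _ lmn; move: mn; rewrite -lm lmn ltnn.
have [_ _ lmn] := lamN; have [x E] := h lmn.
exact: r_uniq E.
Qed.

End Classification.

(** * Transversals for a cyclic quotient *)

Section CyclicQuotient.
Variable alpha : quat R.
Hypothesis alphaK : alpha \in K.
Hypothesis alpha_gen : forall k, k \in K ->
  exists (s : nat) (h : quat R), h \in H /\ k = alpha ^+ s * h.

Lemma cls_generated z : exists s, z = cls alpha *+ s.
Proof.
have [s [h [hH e]]] := alpha_gen (repK z); exists s.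
rewrite -[z]repP e clsM ?KX // ?HK // clsX //.
by rewrite (cls_H hH) addr0.
Qed.

Lemma cls_torsion : exists m, (0 < m)%N && (cls alpha *+ m == 0).
Proof.
(* Pigeonhole: one more power of [alpha] than [K] has elements. *)
pose f (i : 'I_(#|{: K}|.+1)) : K := FSetSub (KX i alphaK).
have /injectivePn[i [j ij fij]] : ~~ injectiveb f.
  by apply/negP => /injectiveP/leq_card; rewrite card_ord ltnn.
have {fij} e : cls alpha *+ i = cls alpha *+ j.
  by rewrite -!clsX //; congr cls; have := congr1 val fij.
wlog ltij : i j ij e / (i < j)%N.
  move=> W; case: (ltngtP i j) => [|ji|/val_inj/eqP]; first exact: W.
    by apply: (W j i) => //; rewrite eq_sym.
  by rewrite (negbTE ij).
exists (j - i)%N; rewrite subn_gt0 ltij /=.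
by rewrite mulrnBr ?(ltnW ltij) // e subrr.
Qed.

(** With [o] the order of the class of [alpha], the map (i, h) to alpha^i h is a bijection from 'I_o
    times H onto K, so the index equals [o]. *)
Lemma cls_order m : (cls alpha *+ m == 0) = (qindex K H %| m)%N.
Proof.
case: (ex_minnP cls_torsion) => o /andP[o0 /eqP ao] o_min.
have dvd_o p : (cls alpha *+ p == 0) = (o %| p)%N.
  apply/idP/idP => [|/dvdnP[q ->]]; last by rewrite mulnC mulrnA ao mul0rn.
  rewrite {1}(divn_eq p o) mulrnDr mulnC mulrnA ao mul0rn add0r => p0.
  rewrite /dvdn; case: posnP => // pp.
  by have := o_min _ (introT andP (conj pp p0)); rewrite leqNgt ltn_pmod.
suff -> : qindex K H = o by [].
have fK (p : 'I_o * H) : alpha ^+ p.1 * fsval p.2 \in K by rewrite KM ?KX // ?HK ?fsvalP.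
pose f p : K := FSetSub (fK p).
have cls_f p : cls (fsval (f p)) = cls alpha *+ p.1.
  rewrite /= clsM ?KX // ?HK ?fsvalP // clsX //.
  by rewrite (cls_H (fsvalP p.2)) addr0.
have f_inj : injective f.
  move=> p q pq; have : cls alpha *+ p.1 = cls alpha *+ q.1 by rewrite -!cls_f pq.
  have lt_eq (i j : 'I_o) : (i <= j)%N -> cls alpha *+ i = cls alpha *+ j -> i = j.
    move=> ij e; apply/val_inj/eqP; rewrite eqn_leq ij /= -subn_eq0.
    have : (o %| j - i)%N by rewrite -dvd_o mulrnBr // e subrr.
    by rewrite /dvdn modn_small // (leq_ltn_trans (leq_subr _ _)).
  move=> e; have {e} e1 : p.1 = q.1.
    by case/orP: (leq_total p.1 q.1) => h; [|symmetry]; apply: lt_eq.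
  have := congr1 val pq; rewrite /= e1 => /(mulrI (K_unit (KX q.1 alphaK))) /val_inj.
  by case: p q e1 {pq} => [? ?] [? ?] /= -> ->.
have f_surj k : k \in codom f.
  have [s [h [hH e]]] := alpha_gen (fsvalP k).
  have so : (s %% o < o)%N by rewrite ltn_pmod.
  have h'H : alpha ^+ (o * (s %/ o)) * h \in H.
    by rewrite HM // -cls_eq0 ?KX // clsX // mulrnA ao mul0rn.
  apply/codomP; exists (Ordinal so, FSetSub h'H); apply: val_inj => /=.
  by rewrite e mulrA -exprD addnC mulnC -divn_eq.
have cardK : #|` K| = (o * #|` H|)%N.
  have card_f : #|codom f| = #|{: K}| by apply: eq_card => k; rewrite f_surj.
  by rewrite cardfE -card_f card_codom // card_prod card_ord -cardfE.
rewrite /qindex cardK mulnK // cardfs_gt0; apply/fset0Pn; by exists 1; apply: H1.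
Qed.

Lemma cyclic_transversal g z : (0 < g)%N -> exists s x,
  (s < gcdn (qindex K H) g)%N /\ z = cls (alpha ^+ s) + x *+ g.
Proof.
move=> g0; set q := gcdn _ _; have q0 : (0 < q)%N by rewrite gcdn_gt0 g0 orbT.
have [u ->] := cls_generated z.
(* Here [v * g = w * qindex K H + gcdn g (qindex K H)], and the index annihilates the class of
   [alpha]; so the quotient part of [u] is absorbed by a multiple of [g]. *)
case: (egcdnP (qindex K H) g0) => v w e _.
exists (u %% q)%N, (cls alpha *+ (v * (u %/ q))); rewrite ltn_pmod //; split=> //.
have N0 : cls alpha *+ qindex K H = 0 by apply/eqP; rewrite cls_order.
rewrite clsX // {1}(divn_eq u q) addnC mulrnDr; congr (_ + _).
rewrite -mulrnA mulnAC e mulnDl mulrnDr [X in _ = X + _](_ : _ = 0) ?add0r.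
  by rewrite gcdnC mulnC.
by rewrite [(w * _)%N]mulnC -mulnA mulrnA N0 mul0rn.
Qed.

(** The exponents agree modulo the index up to a multiple of [g], hence modulo the gcd, below which
    both lie. *)
Lemma cyclic_transversal_inj g s s' x :
  (s < gcdn (qindex K H) g)%N -> (s' < gcdn (qindex K H) g)%N ->
  cls (alpha ^+ s) = cls (alpha ^+ s') + x *+ g -> s = s'.
Proof.
move=> sq s'q; have [u ->] := cls_generated x; rewrite !clsX // -mulrnA -mulrnDr => e.
have cong i j : cls alpha *+ i = cls alpha *+ j -> i = j %[mod gcdn (qindex K H) g].
  wlog ij : i j / (i <= j)%N.
    by move=> W E; case/orP: (leq_total i j) => h; [|symmetry]; apply: W.
  move=> E; apply/esym/eqP; rewrite eqn_mod_dvd //.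
  apply: dvdn_trans (dvdn_gcdl _ _) _.
  by rewrite -cls_order mulrnBr // E subrr.
have := cong _ _ e; rewrite -modnDmr.
have /eqP -> : (u * g == 0 %[mod gcdn (qindex K H) g])%N.
  by rewrite mod0n; apply: dvdn_mull; apply: dvdn_gcdr.
by rewrite mod0n addn0 !modn_small.
Qed.

End CyclicQuotient.

(** In the abelian quotient x a x^-1 = a^-1 says that the class of [a] is killed by 2; then x^2 is
    an even power of [a], so the class of [x] is killed by 2 as well. *)
Lemma binary_dihedral_exponent m : binary_dihedral K (2 * m) ->
  forall z : KH, z *+ 2 = 0.
Proof.
case=> a [x [_ _ x2 conj [Kgen aK xK _]]] z.
have a2 : cls a *+ 2 = 0.
  have := congr1 cls conj; rewrite clsV // cls_div ?KM // clsM // addrC addKr => e.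
  by rewrite mulr2n {1}e addNr.
have {}x2 : cls x *+ 2 = 0 by rewrite -clsX // x2 clsX // mulrnA a2 mul0rn.
have [i [e E]] := (Kgen _).1 (repK z).
rewrite -[z]repP E clsM ?KX // !clsX // mulrnDl.
by rewrite -!mulrnA ![(_ * 2)%N]mulnC !mulrnA a2 x2 !mul0rn addr0.
Qed.

End AbelianQuotient.

Local Open Scope fset_scope.

Theorem theorem4p10 (R : realType) (n : nat) (K H : {fset quat R}) :
  (3 <= n)%N ->
  is_qsubgroup K -> normal_in H K -> commutators_in K H -> H != [fset 1] ->
  (* (a) K/H cyclic, generated by the coset of alpha *)
  (forall alpha : quat R, alpha \in K ->
     (forall k, k \in K -> exists (s : nat) (h : quat R), h \in H /\ k = alpha ^+ s * h) ->
     parabolic_reps K H n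
       (fun i : seq nat * nat =>
          (exists m, (m < n)%N /\ is_partition i.1 m /\ i.2 = 0%N)
          \/ (is_partition i.1 n /\ (i.2 < gcdn (qindex K H) (gcd_parts i.1))%N))
       (fun i => P_lambda K H n i.1 (alpha ^+ i.2)))
  /\
  (* (b) K binary dihedral of order 8d, H = [K,K], cosets H, alpha H, beta H, gamma H *)
  (forall d : nat, (2 <= d)%N -> binary_dihedral K (2 * d) ->
     is_commutator_subgroup H K ->
     forall alpha beta gamma : quat R,
       let r := [:: 1; alpha; beta; gamma] in
       alpha \in K -> beta \in K -> gamma \in K ->
       (forall i j : 'I_4, i != j -> (r`_i)^-1 * r`_j \notin H) ->
       (forall k, k \in K -> exists i : 'I_4, (r`_i)^-1 * k \in H) ->
     parabolic_reps K H n
       (fun i : seq nat * nat =>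
          (exists m, (m < n)%N /\ is_partition i.1 m /\ i.2 = 0%N)
          \/ (is_partition i.1 n /\ odd (gcd_parts i.1) /\ i.2 = 0%N)
          \/ (is_partition i.1 n /\ ~~ odd (gcd_parts i.1) /\ (i.2 < 4)%N))
       (fun i => P_lambda K H n i.1 r`_(i.2))).
Proof.
move=> n3 K_group H_normal K_comm H_neq1.
have n0 : (0 < n)%N by lia.
have [h hH h1] : exists2 h, h \in H & h != 1.
  have H_1 := H1 H_normal.
  apply/exists2P/not_existsP => none; move/eqP: H_neq1; apply.
  apply/fsetP => x; rewrite inE; apply/idP/eqP => [xH|-> //].
  by apply/eqP/negPn/negP => x1; apply: (none x).
have H_nt : exists2 h, h \in H & h != 1 by exists h.
split=> [alpha alphaK alpha_gen|d d2 K_dih _ alpha beta gamma r aK bK cK r_inj r_surj].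
  have gcd0 lam : is_partition lam n -> (0 < gcd_parts lam)%N.
    case=> _ pos sum_n; case: lam pos sum_n => [|a lam] /=; first by lia.
    by case/andP=> a0 _ _; rewrite gcd_parts_cons gcdn_gt0 a0.
  apply: (@parabolic_reps_of_transversal _ _ _ K_group H_normal K_comm _ n0 H_nt
    (fun s => alpha ^+ s) (fun lam => gcdn (qindex K H) (gcd_parts lam))).
  - exact: expr0.
  - by move=> lam s _ _; apply: KX.
  - by move=> lam z /gcd0; apply: cyclic_transversal.
  - by move=> lam s s' x _; apply: cyclic_transversal_inj.
have KH2 := @binary_dihedral_exponent _ _ _ K_group H_normal K_comm _ K_dih.
have KHg (x : KH K_group H_normal) g : x *+ g = x *+ odd g.
  by rewrite -{1}(odd_double_half g) -mul2n mulrnDr mulrnA KH2 mul0rn addr0.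
have rK s : (s < 4)%N -> r`_s \in K.
  by case: s => [|[|[|[|s]]]] //= _; apply: K1.
(* In exponent 2, odd powers exhaust K/H, leaving one representative, while even powers are trivial,
   leaving all four. *)
pose bound lam := if odd (gcd_parts lam) then 1%N else 4%N.
rewrite (_ : (fun i : seq nat * nat => _ \/ _) = (fun i : seq nat * nat =>
    (exists m, (m < n)%N /\ is_partition i.1 m /\ i.2 = 0%N)
    \/ (is_partition i.1 n /\ (i.2 < bound i.1)%N))); last first.
  apply/funext => -[lam s]; apply/propext; rewrite /bound /=.
  split=> -[|]; try (by left); last first.
    by case: ifP => g [P sb]; right; [left | right]; split=> //; split=> //; lia.
  by case=> -[P [g sb]]; right; rewrite ?g ?(negbTE g) ?sb.
apply: (@parabolic_reps_of_transversal _ _ _ K_group H_normal K_comm _ n0 H_nt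
  (fun s => r`_s) bound) => //.
- by move=> lam s _ sb; apply: rK; move: sb; rewrite /bound; case: ifP => _; lia.
- move=> lam z _; rewrite /bound; case: ifP => g.
    (* For an odd gcd the class [z] is its own gcd-th multiple, so it is absorbed entirely. *)
    exists 0%N, z; rewrite KHg g; split=> //.
    by rewrite [r`_0]/= cls1 add0r.
  have [i /= iH] := r_surj _ (repK z); exists i, z; split=> //.
  rewrite KHg g mulr0n addr0 -[LHS]repP; apply/esym/eqP.
  by rewrite cls_eq ?repK // rK.
move=> lam s s' x _; rewrite /bound KHg; case: ifP => g; first by lia.
move=> s4 s'4; rewrite mulr0n addr0 => /eqP; rewrite cls_eq ?rK // => e.
apply/eqP; apply: contraT => ss'.
by have := r_inj (Ordinal s4) (Ordinal s'4) ss'; rewrite e.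
Qed.
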